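(* Let $T$ be a complete first-order theory in a countable language having an uncountable atomic model, and let $\mathrm{At}$ be the class of atomic models of $T$. If $\mathrm{At}$ is $\aleph_1$-categorical, then $C_M$ is countable for every (equivalently, some) countable atomic model $M$.
   Context: A set is atomic if every finite tuple from it realizes a type over $\emptyset$ isolated by a single formula. For $M\in\mathrm{At}$, $S_{at}(M)$ is the set of complete types $p\in S(M)$ (in finitely many variables) such that if $\mathbf a$ realizes $p$ then $M\mathbf a$ is an atomic set. A type $p\in S_{at}(M)$ splits over $F\subseteq M$ if there are tuples $\mathbf b,\mathbf b'$ from $M$ and a formula $\phi(\mathbf x,\mathbf y)$ with $\mathrm{tp}(\mathbf b/F)=\mathrm{tp}(\mathbf b'/F)$ and $\phi(\mathbf x,\mathbf b)\wedge\neg\phi(\mathbf x,\mathbf b')\in p$. $p$ is constrained if it does not split over some finite $F\subseteq M$. $C_M$ denotes the set of constrained types in $S_{at}(M)$. $\mathrm{At}$ is $\aleph_1$-categorical if it has exactly one model of size $\aleph_1$ up to isomorphism. *)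

(* Defs.v *)
From Stdlib Require Import Arith List.
From Stdlib Require Fin.

Record Lang := {
  Fsym : Type;
  Rsym : Type;
  farity : Fsym -> nat;
  rarity : Rsym -> nat
}.

Definition countable_language (L : Lang) : Prop :=
  (exists f : Fsym L -> nat, forall x y, f x = f y -> x = y) /\
  (exists g : Rsym L -> nat, forall x y, g x = g y -> x = y).

Inductive term (L : Lang) : Type :=
| var : nat -> term L
| app : forall f : Fsym L, (Fin.t (farity L f) -> term L) -> term L.

Inductive formula (L : Lang) : Type :=
| FEq : term L -> term L -> formula L
| FRel : forall r : Rsym L, (Fin.t (rarity L r) -> term L) -> formula L
| FBot : formula L
| FImp : formula L -> formula L -> formula L
| FAll : nat -> formula L -> formula L.

Arguments var {L} _.
Arguments FBot {L}.
Arguments app {L} f _.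
Arguments FEq {L} _ _.
Arguments FRel {L} r _.
Arguments FImp {L} _ _.
Arguments FAll {L} _ _.

Definition FNot {L : Lang} (phi : formula L) : formula L := FImp phi FBot.

Fixpoint free_in_term {L : Lang} (x : nat) (t : term L) : Prop :=
  match t with
  | var i => i = x
  | app _ args => exists j, free_in_term x (args j)
  end.

Fixpoint free_in {L : Lang} (x : nat) (phi : formula L) : Prop :=
  match phi with
  | FEq t u => free_in_term x t \/ free_in_term x u
  | FRel _ args => exists j, free_in_term x (args j)
  | FBot => False
  | FImp a b => free_in x a \/ free_in x b
  | FAll y a => y <> x /\ free_in x a
  end.

Definition fv_below {L : Lang} (k : nat) (phi : formula L) : Prop :=
  forall x, free_in x phi -> x < k.

Definition sentence {L : Lang} (phi : formula L) : Prop :=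
  forall x, ~ free_in x phi.

Record Structure (L : Lang) := {
  carrier :> Type;
  carrier_inhabited : inhabited carrier;
  funs : forall f : Fsym L, (Fin.t (farity L f) -> carrier) -> carrier;
  rels : forall r : Rsym L, (Fin.t (rarity L r) -> carrier) -> Prop
}.

Arguments funs {L} _ _ _.
Arguments rels {L} _ _ _.
Fixpoint eval {L : Lang} (M : Structure L) (s : nat -> M) (t : term L) : M :=
  match t with
  | var i => s i
  | app f args => funs M f (fun j => eval M s (args j))
  end.

Definition upd {A : Type} (s : nat -> A) (x : nat) (a : A) : nat -> A :=
  fun i => if Nat.eqb i x then a else s i.

Fixpoint sat {L : Lang} (M : Structure L) (s : nat -> M) (phi : formula L) : Prop :=
  match phi with
  | FEq t u => eval M s t = eval M s u
  | FRel r args => rels M r (fun j => eval M s (args j))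
  | FBot => False
  | FImp a b => sat M s a -> sat M s b
  | FAll x a => forall m : M, sat M (upd s x m) a
  end.

Definition is_model {L : Lang} (T : formula L -> Prop) (M : Structure L) : Prop :=
  forall phi, T phi -> forall s : nat -> M, sat M s phi.

(* complete (consistent) first-order theory; by the completeness theorem,
   T |- phi is rendered semantically as "phi holds in every model of T". *)
Definition complete_theory {L : Lang} (T : formula L -> Prop) : Prop :=
  (forall phi, T phi -> sentence phi) /\
  (exists M : Structure L, is_model T M) /\
  (forall phi, sentence phi ->
     (forall M : Structure L, is_model T M -> forall s, sat M s phi) \/
     (forall M : Structure L, is_model T M -> forall s, sat M s (FNot phi))).

Definition atomic_set {L : Lang} (N : Structure L) (A : N -> Prop) : Prop :=
  forall (k : nat) (b : nat -> N), (forall i, i < k -> A (b i)) ->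
    exists psi : formula L, fv_below k psi /\ sat N b psi /\
      forall phi : formula L, fv_below k phi ->
        forall c : nat -> N, sat N c psi -> (sat N c phi <-> sat N b phi).

Definition atomic_model {L : Lang} (T : formula L -> Prop) (M : Structure L) : Prop :=
  is_model T M /\ atomic_set M (fun _ => True).

Definition countable_type (X : Type) : Prop :=
  exists f : X -> nat, forall x y, f x = f y -> x = y.

Definition countable_subset {X : Type} (A : X -> Prop) : Prop :=
  exists f : X -> nat, forall x y, A x -> A y -> f x = f y -> x = y.

(* |X| = aleph_1 : X is uncountable and every uncountable subset of X
   is equinumerous with X (i.e. aleph_1 is the least uncountable cardinal). *)
Definition size_aleph1 (X : Type) : Prop :=
  ~ countable_type X /\
  forall A : X -> Prop, ~ countable_subset A ->
    exists f : {x : X | A x} -> X,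
      (forall u v, f u = f v -> u = v) /\ (forall y, exists u, f u = y).

Definition isomorphic {L : Lang} (M N : Structure L) : Prop :=
  exists (f : M -> N) (g : N -> M),
    (forall x, g (f x) = x) /\ (forall y, f (g y) = y) /\
    (forall fs args, f (funs M fs args) = funs N fs (fun j => f (args j))) /\
    (forall r args, rels M r args <-> rels N r (fun j => f (args j))).

Definition aleph1_categorical_At {L : Lang} (T : formula L -> Prop) : Prop :=
  (exists M : Structure L, atomic_model T M /\ size_aleph1 M) /\
  (forall M N : Structure L, atomic_model T M -> size_aleph1 M ->
     atomic_model T N -> size_aleph1 N -> isomorphic M N).

Definition elementary_embedding {L : Lang} (M N : Structure L) (e : M -> N) : Prop :=
  forall (phi : formula L) (s : nat -> M), sat M s phi <-> sat N (fun i => e (s i)) phi.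

(* A (candidate) type over M in n variables: p phi s means "phi(x_0..x_{n-1}; s) in p",
   the variables x_i with i >= n being parameters assigned the value s i in M. *)
Definition pretype {L : Lang} (M : Structure L) : Type := formula L -> (nat -> M) -> Prop.

Definition realizes {L : Lang} (M N : Structure L) (e : M -> N) (n : nat)
    (a : nat -> N) (p : pretype M) : Prop :=
  forall phi s, p phi s <-> sat N (fun i => if i <? n then a i else e (s i)) phi.

(* S_n(M): complete types over M in n variables, i.e. types of n-tuples
   in elementary extensions of M. *)
Definition in_S {L : Lang} (M : Structure L) (n : nat) (p : pretype M) : Prop :=
  exists (N : Structure L) (e : M -> N) (a : nat -> N),
    elementary_embedding M N e /\ realizes M N e n a p.

Definition in_S_at {L : Lang} (M : Structure L) (n : nat) (p : pretype M) : Prop :=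
  in_S M n p /\
  forall (N : Structure L) (e : M -> N) (a : nat -> N),
    elementary_embedding M N e -> realizes M N e n a p ->
    atomic_set N (fun y => (exists m, y = e m) \/ (exists i, i < n /\ y = a i)).

Definition merge {A : Type} (k : nat) (b f : nat -> A) : nat -> A :=
  fun i => if i <? k then b i else f i.

Definition same_type_over {L : Lang} (M : Structure L) (F : M -> Prop) (k : nat)
    (b b' : nat -> M) : Prop :=
  forall (m : nat) (theta : formula L) (f : nat -> M),
    fv_below (k + m) theta ->
    (forall i, k <= i -> i < k + m -> F (f i)) ->
    (sat M (merge k b f) theta <-> sat M (merge k b' f) theta).

(* p (in n variables) splits over F: there are k-tuples b, b' from M with the
   same type over F and phi(x,y) (x = x_0..x_{n-1}, y = x_n..x_{n+k-1})
   with phi(x,b) /\ ~phi(x,b') in p. *)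
Definition splits_over {L : Lang} (M : Structure L) (n : nat) (p : pretype M)
    (F : M -> Prop) : Prop :=
  exists (k : nat) (b b' : nat -> M) (phi : formula L),
    same_type_over M F k b b' /\ fv_below (n + k) phi /\
    p phi (fun i => b (i - n)) /\ p (FNot phi) (fun i => b' (i - n)).

Definition finite_subset {X : Type} (F : X -> Prop) : Prop :=
  exists l : list X, forall x, F x <-> List.In x l.

Definition constrained {L : Lang} (M : Structure L) (n : nat) (p : pretype M) : Prop :=
  exists F : M -> Prop, finite_subset F /\ ~ splits_over M n p F.

Definition in_C {L : Lang} (M : Structure L) (n : nat) (p : pretype M) : Prop :=
  in_S_at M n p /\ constrained M n p.

Definition countable_C {L : Lang} (M : Structure L) : Prop :=
  exists g : nat -> nat * pretype M,
    forall n p, in_C M n p ->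
      exists k, fst (g k) = n /\ forall phi s, snd (g k) phi s <-> p phi s.

(* Main.v *)
(** Fix a countable atomic model K and suppose that uncountably many types over K do not
    split over some fixed finite tuple a.  Such a type is determined by the real telling
    which formulas phi(x,y) and chi(a,y) hold jointly for some y in K, and it makes sense
    over every atomic model containing a copy of a.  For each such nonrealized q and each
    real r outside a countable set depending on q, there is an atomic model of size aleph_1
    in which q is realized over every countable subset, whereas every copy of a lies in a
    countable elementary submodel over which no tuple computes r.  It is a union of
    countable atomic models; each step embeds the previous model, together with a
    realization of q over it, generically into K.  By genericity, a tuple of the larger
    model computing r would come from a finite condition, and since q does not split over a,
    this condition already lets a tuple of the smaller model compute r.  Taking r to be the
    real of a second type p, the models built for p (with any admissible real) and for
    (q, r) cannot be isomorphic: in the first p is realized over every countable subset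
    containing a, and a realization computes r. *)

From Stdlib Require Import Arith List Lia Cantor Classical ClassicalEpsilon.
From Stdlib Require Import FunctionalExtensionality PropExtensionality.
From Stdlib Require Fin.
From mathcomp Require classical_sets.
Require Import Defs.

(** The omission of [r] has to survive every later step, and this dictates the class of procedures.
    Once a finite condition is fixed, reading a bit off a tuple of the next model becomes another
    kind of reading in the present one: the bit counts as true if some extension of the condition
    makes it true. The procedures are closed under this passage from the outset, a code listing the
    conditions and tuples absorbed so far. Isolation of types in [K] and invariance of [q] over [a]
    make the passage expressible by formulas. Codes and tuples are finite data from the countable
    [K], so for a given [q] they exclude only countably many reals.

    Zorn's lemma replaces recursion on countable ordinals. All partial models live on subsets of one
    type of size aleph_1, supplied by the existence half of categoricity; a maximal one is
    uncountable, hence of size aleph_1. Each point carries its own countable stage, fixed once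
    assigned, so that stages survive unions.

    A third type enters at the end, because the model built for [p] must itself omit some real
    admissible for [p]. *)

(** * Choice and Zorn's lemma for preorders *)

Lemma choice {A B : Type} (R : A -> B -> Prop) :
  (forall x, exists y, R x y) -> exists f : A -> B, forall x, R x (f x).
Proof.
  intros H.
  exists (fun x => proj1_sig (constructive_indefinite_description _ (H x))).
  intros x. exact (proj2_sig (constructive_indefinite_description _ (H x))).
Qed.

Lemma zorn_preorder {P : Type} (t0 : P) (R : P -> P -> Prop) :
  (forall t, R t t) ->
  (forall r s t, R r s -> R s t -> R r t) ->
  (forall A : P -> Prop, (forall s t, A s -> A t -> R s t \/ R t s) ->
     exists t, forall s, A s -> R s t) ->
  exists t, forall s, R t s -> R s t.
Proof.
  intros Hr Ht Hc.
  pose (Rb := fun s t : P =>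
    if excluded_middle_informative (R s t) then true else false).
  assert (E : forall s t, is_true (Rb s t) <-> R s t).
  { intros s t. unfold Rb. destruct (excluded_middle_informative (R s t)) as [h|h].
    - split; [auto | reflexivity].
    - split; [discriminate | contradiction]. }
  destruct (@classical_sets.ZL_preorder P t0 Rb) as [t Hm].
  - intros t. apply E, Hr.
  - intros r s t H1 H2. apply E. apply Ht with s; apply E; assumption.
  - intros A HA. destruct (Hc A) as [t Htt].
    + intros s t Hs Ht'. destruct (HA s t Hs Ht') as [h|h]; [left|right]; apply E, h.
    + exists t. intros s Hs. apply E, Htt, Hs.
  - exists t. intros s Hs. apply E, Hm, E, Hs.
Qed.

(** * Countability *)

Lemma countable_prod {A B : Type} :
  countable_type A -> countable_type B -> countable_type (A * B).
Proof.
  intros [f Hf] [g Hg]. exists (fun p => to_nat (f (fst p), g (snd p))).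
  intros [x y] [x' y'] H. apply (f_equal of_nat) in H.
  rewrite !cancel_of_to in H. simpl in H. injection H as H1 H2.
  f_equal; auto.
Qed.

Lemma countable_list {A : Type} : countable_type A -> countable_type (list A).
Proof.
  intros [f Hf].
  pose (c := fix c l := match l with nil => 0 | cons x l => S (to_nat (f x, c l)) end).
  exists c. intros l. induction l as [|x l IH]; intros [|y l'] H; try discriminate; auto.
  change (S (to_nat (f x, c l)) = S (to_nat (f y, c l'))) in H.
  apply eq_add_S, (f_equal of_nat) in H. rewrite !cancel_of_to in H.
  injection H as H1 H2. f_equal; auto.
Qed.

Lemma countable_sum {A B : Type} :
  countable_type A -> countable_type B -> countable_type (A + B).
Proof.
  intros [f Hf] [g Hg].
  exists (fun z => match z with inl x => 2 * f x | inr y => S (2 * g y) end).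
  intros [x|x] [y|y] H; try lia; f_equal; [apply Hf | apply Hg]; lia.
Qed.

Lemma countable_nat : countable_type nat.
Proof. exists (fun n => n). auto. Qed.

Lemma countable_subset_mono {X : Type} (A B : X -> Prop) :
  (forall x, A x -> B x) -> countable_subset B -> countable_subset A.
Proof. intros H [f Hf]. exists f. auto. Qed.

Lemma countable_subset_range {I X : Type} (j : I -> X) :
  countable_type I -> countable_subset (fun x => exists i, x = j i).
Proof.
  intros [f Hf].
  destruct (classic (inhabited I)) as [[i0]|Hn].
  - destruct (choice (fun x i => (exists i, x = j i) -> x = j i)) as [g Hg].
    { intros x. destruct (classic (exists i, x = j i)) as [[i Hi]|h].
      - exists i. auto.
      - exists i0. intros h'. contradiction. }
    exists (fun x => f (g x)). intros x y Hx Hy H. apply Hf in H.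
    rewrite (Hg x Hx), (Hg y Hy), H. reflexivity.
  - exists (fun _ => 0). intros x y [i _]. destruct Hn. constructor. exact i.
Qed.

Lemma countable_subset_union {I X : Type} (A : I -> X -> Prop) :
  countable_type I -> (forall i, countable_subset (A i)) ->
  countable_subset (fun x => exists i, A i x).
Proof.
  intros HI HA. destruct (choice _ HA) as [f Hf].
  destruct (countable_prod HI countable_nat) as [h Hh].
  destruct (classic (inhabited I)) as [[i0]|Hn].
  - destruct (choice (fun x i => (exists i, A i x) -> A i x)) as [g Hg].
    { intros x. destruct (classic (exists i, A i x)) as [[i Hi]|h'].
      - exists i. auto.
      - exists i0. intros h2. contradiction. }
    exists (fun x => h (g x, f (g x) x)). intros x y Hx Hy H. apply Hh in H.
    injection H as H1 H2. rewrite <- H1 in H2. apply (Hf (g x)); auto.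
    rewrite H1. auto.
  - exists (fun _ => 0). intros x y [i _]. destruct Hn. constructor. exact i.
Qed.

Lemma countable_subset_enum {X : Type} (A : X -> Prop) (x0 : X) :
  A x0 -> countable_subset A ->
  exists d : nat -> X, (forall i, A (d i)) /\ forall x, A x -> exists i, x = d i.
Proof.
  intros H0 [f Hf].
  destruct (choice (fun i x => A x /\ ((exists y, A y /\ f y = i) -> f x = i)))
    as [d Hd].
  { intros i. destruct (classic (exists y, A y /\ f y = i)) as [[y [Hy Hi]]|h].
    - exists y. auto.
    - exists x0. split; [assumption|]. intros h'. contradiction. }
  exists d. split; [intros i; apply Hd|]. intros x Hx. exists (f x).
  apply Hf; [assumption | apply Hd |]. symmetry. apply Hd. eauto.
Qed.

Lemma countable_subset_In {X : Type} (l : list X) : countable_subset (fun x => In x l).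
Proof.
  destruct (choice (fun x i => In x l -> nth_error l i = Some x)) as [c Hc].
  { intros x. destruct (classic (In x l)) as [h|h].
    - destruct (In_nth_error l x h) as [i Hi]. eauto.
    - exists 0. contradiction. }
  exists c. intros x y Hx Hy H. apply Hc in Hx, Hy. congruence.
Qed.

Lemma nat_embeds_in_uncountable {X : Type} (A : X -> Prop) :
  ~ countable_subset A ->
  exists f : nat -> X, (forall i, A (f i)) /\ forall i j, f i = f j -> i = j.
Proof.
  intros HA.
  destruct (choice (fun (l : list X) x => A x /\ ~ In x l)) as [g Hg].
  { intros l. apply NNPP. intros H. apply HA.
    apply countable_subset_mono with (fun x => In x l); [|apply countable_subset_In].
    intros x Hx. apply NNPP. eauto. }
  pose (acc := fix acc i := match i with 0 => nil | S i => cons (g (acc i)) (acc i) end).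
  assert (Hin : forall i j, i < j -> In (g (acc i)) (acc j)).
  { intros i j H. induction H as [|j H IH]; simpl; auto. }
  exists (fun i => g (acc i)). split; [intros i; apply Hg|].
  intros i j H. destruct (lt_eq_lt_dec i j) as [[h|h]|h]; auto.
  - destruct (proj2 (Hg (acc j))). rewrite <- H. auto.
  - destruct (proj2 (Hg (acc i))). rewrite H. auto.
Qed.

(** * Formulas *)

Definition prepend {A : Type} (k : nat) (a s : nat -> A) : nat -> A :=
  fun i => if i <? k then a i else s (i - k).

Ltac decide_lt :=
  repeat match goal with
  | |- context [?x <? ?y] => destruct (Nat.ltb_spec x y)
  | |- context [?x =? ?y] => destruct (Nat.eqb_spec x y)
  end.

Lemma prepend_lt {A : Type} k (a s : nat -> A) i : i < k -> prepend k a s i = a i.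
Proof. intros H. unfold prepend. decide_lt; auto; lia. Qed.

Lemma prepend_ge {A : Type} k (a s : nat -> A) i :
  prepend k a s (k + i) = s i.
Proof. unfold prepend. decide_lt; [lia|]. f_equal. lia. Qed.

Lemma prepend_comp {A B : Type} (f : A -> B) k (a s : nat -> A) :
  (fun i => f (prepend k a s i)) = prepend k (fun i => f (a i)) (fun i => f (s i)).
Proof. extensionality i. unfold prepend. decide_lt; reflexivity. Qed.

Lemma prepend_all {A : Type} (P : A -> Prop) k (a s : nat -> A) :
  (forall i, i < k -> P (a i)) -> (forall i, P (s i)) -> forall i, P (prepend k a s i).
Proof. intros H1 H2 i. unfold prepend. decide_lt; auto. Qed.

Lemma upd_same {A : Type} (s : nat -> A) x m : upd s x m x = m.
Proof. unfold upd. rewrite Nat.eqb_refl. reflexivity. Qed.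

Lemma upd_other {A : Type} (s : nat -> A) x m y : y <> x -> upd s x m y = s y.
Proof. intros H. unfold upd. decide_lt; congruence. Qed.

Lemma upd_all {A : Type} (P : A -> Prop) (s : nat -> A) x m :
  (forall i, P (s i)) -> P m -> forall i, P (upd s x m i).
Proof. intros H1 H2 i. unfold upd. decide_lt; auto. Qed.

Lemma upd_comp {A B : Type} (f : A -> B) (s : nat -> A) x m :
  (fun i => f (upd s x m i)) = upd (fun i => f (s i)) x (f m).
Proof. extensionality i. unfold upd. decide_lt; reflexivity. Qed.

Section Formulas.
Context {L : Lang}.

Definition FAnd (phi psi : formula L) : formula L := FNot (FImp phi (FNot psi)).
Definition FEx (x : nat) (phi : formula L) : formula L := FNot (FAll x (FNot phi)).

Lemma sat_and (M : Structure L) s phi psi :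
  sat M s (FAnd phi psi) <-> sat M s phi /\ sat M s psi.
Proof. simpl. tauto. Qed.

Lemma sat_ex (M : Structure L) s x phi :
  sat M s (FEx x phi) <-> exists m, sat M (upd s x m) phi.
Proof.
  simpl. split.
  - intros H. apply NNPP. intros H'. apply H. intros m Hm. eauto.
  - intros [m Hm] H. exact (H m Hm).
Qed.

Lemma eval_agree (M : Structure L) (t : term L) s s' :
  (forall x, free_in_term x t -> s x = s' x) -> eval M s t = eval M s' t.
Proof.
  induction t as [x|f args IH]; simpl; intros H.
  - apply H. reflexivity.
  - f_equal. extensionality j. apply IH. eauto.
Qed.

Lemma sat_agree (M : Structure L) (phi : formula L) : forall s s',
  (forall x, free_in x phi -> s x = s' x) -> (sat M s phi <-> sat M s' phi).
Proof.
  induction phi as [t u|r args| |phi IH1 psi IH2|x phi IH]; simpl; intros s s' H.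
  - rewrite (eval_agree M t s s'), (eval_agree M u s s') by auto. tauto.
  - replace (fun j => eval M s (args j)) with (fun j => eval M s' (args j)); [tauto|].
    extensionality j. symmetry. apply eval_agree. eauto.
  - tauto.
  - rewrite (IH1 s s'), (IH2 s s') by auto. tauto.
  - assert (E : forall m, sat M (upd s x m) phi <-> sat M (upd s' x m) phi).
    { intros m. apply IH. intros y Hy. unfold upd. decide_lt; auto. }
    split; intros Hm m; apply E, Hm.
Qed.

Lemma sat_agree_below (M : Structure L) (phi : formula L) k s s' :
  fv_below k phi -> (forall x, x < k -> s x = s' x) -> (sat M s phi <-> sat M s' phi).
Proof. intros H1 H2. apply sat_agree. auto. Qed.

Lemma bounded_below (f : nat -> nat) n : exists b, forall x, x < n -> f x < b.
Proof.
  induction n as [|n [b IH]].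
  - exists 0. intros; lia.
  - exists (S (b + f n)). intros x Hx.
    destruct (Nat.eq_dec x n) as [->|h]; [lia|]. specialize (IH x). lia.
Qed.

Lemma bounded_Fin n (f : Fin.t n -> nat) : exists b, forall j, f j < b.
Proof.
  induction n as [|n IH].
  - exists 0. intros j. inversion j.
  - destruct (IH (fun j => f (Fin.FS j))) as [b Hb].
    exists (S (b + f Fin.F1)). intros j. apply (Fin.caseS' j); [lia|].
    intros j'. specialize (Hb j'). simpl in Hb. lia.
Qed.

Lemma term_fv_below (t : term L) : exists b, forall x, free_in_term x t -> x < b.
Proof.
  induction t as [x|f args IH]; simpl.
  - exists (S x). intros; lia.
  - destruct (choice _ IH) as [g Hg]. destruct (bounded_Fin _ g) as [b Hb].
    exists b. intros x [j Hj]. specialize (Hg j x Hj). specialize (Hb j). lia.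
Qed.

Lemma fv_below_mono k k' (phi : formula L) : k <= k' -> fv_below k phi -> fv_below k' phi.
Proof. intros H Hf x Hx. specialize (Hf x Hx). lia. Qed.

Lemma formula_fv_below (phi : formula L) : exists b, fv_below b phi.
Proof.
  unfold fv_below.
  induction phi as [t u|r args| |phi [b IH1] psi [b' IH2]|y phi [b IH]]; simpl.
  - destruct (term_fv_below t) as [b Hb], (term_fv_below u) as [b' Hb'].
    exists (b + b'). intros x [H|H]; [specialize (Hb x H)|specialize (Hb' x H)]; lia.
  - destruct (choice _ (fun j => term_fv_below (args j))) as [g Hg].
    destruct (bounded_Fin _ g) as [b Hb].
    exists b. intros x [j Hj]. specialize (Hg j x Hj). specialize (Hb j). lia.
  - exists 0. tauto.
  - exists (b + b'). intros x [H|H]; [specialize (IH1 x H)|specialize (IH2 x H)]; lia.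
  - exists b. intros x [_ H]. auto.
Qed.

Fixpoint rename_term (rho : nat -> nat) (t : term L) : term L :=
  match t with
  | var i => var (rho i)
  | app f args => app f (fun j => rename_term rho (args j))
  end.

Lemma eval_rename (M : Structure L) rho (t : term L) s :
  eval M s (rename_term rho t) = eval M (fun i => s (rho i)) t.
Proof.
  induction t as [x|f args IH]; simpl; [reflexivity|].
  f_equal. extensionality j. apply IH.
Qed.

Lemma free_in_rename rho (t : term L) x :
  free_in_term x (rename_term rho t) -> exists y, free_in_term y t /\ x = rho y.
Proof.
  induction t as [i|f args IH]; simpl.
  - intros <-. eauto.
  - intros [j Hj]. destruct (IH j Hj) as [y [H1 H2]]. eauto.
Qed.

(** Only the existence of a renamed formula with the right semantics is claimed, so the bound
    variables can be chosen inside the induction to avoid capture. The map [rho] may be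
    non-injective, which is what allows parameters to be repeated later. *)
Lemma rename_formula (phi : formula L) : forall rho : nat -> nat,
  exists phi' : formula L,
    (forall (M : Structure L) s, sat M s phi' <-> sat M (fun i => s (rho i)) phi) /\
    (forall x, free_in x phi' -> exists y, free_in y phi /\ x = rho y).
Proof.
  induction phi as [t u|r args| |phi IH1 psi IH2|x phi IH]; intros rho.
  - exists (FEq (rename_term rho t) (rename_term rho u)). split.
    + intros M s. simpl. rewrite !eval_rename. tauto.
    + simpl. intros x [H|H]; apply free_in_rename in H; destruct H as [y [H1 H2]]; eauto.
  - exists (FRel r (fun j => rename_term rho (args j))). split.
    + intros M s. simpl.
      replace (fun j => eval M s (rename_term rho (args j)))
        with (fun j => eval M (fun i => s (rho i)) (args j)); [tauto|].
      extensionality j. symmetry. apply eval_rename.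
    + simpl. intros x [j H]. apply free_in_rename in H. destruct H as [y [H1 H2]]; eauto.
  - exists FBot. simpl. firstorder.
  - destruct (IH1 rho) as [phi' [H1 H2]], (IH2 rho) as [psi' [H3 H4]].
    exists (FImp phi' psi'). split.
    + intros M s. simpl. rewrite H1, H3. tauto.
    + simpl. intros x [H|H]; [destruct (H2 x H) as [y [? ?]]|destruct (H4 x H) as [y [? ?]]]; eauto.
  - (* the bound variable is renamed to some [z] beyond all images of free variables *)
    destruct (formula_fv_below phi) as [b Hb].
    destruct (bounded_below rho b) as [z Hz].
    destruct (IH (upd rho x z)) as [phi' [H1 H2]].
    exists (FAll z phi'). split.
    + intros M s. simpl.
      assert (E : forall m, sat M (upd s z m) phi' <->
                            sat M (upd (fun i => s (rho i)) x m) phi).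
      { intros m. rewrite H1. apply sat_agree. intros y Hy. specialize (Hz y (Hb y Hy)).
        unfold upd at 2 3. destruct (Nat.eqb_spec y x) as [->|h].
        - apply upd_same.
        - apply upd_other. lia. }
      split; intros H m; apply E, H.
    + simpl. intros y [Hy H]. destruct (H2 y H) as [v [Hv ->]].
      revert Hy. unfold upd. destruct (Nat.eqb_spec v x) as [->|h]; [congruence|].
      intros _. exists v. auto.
Qed.

End Formulas.

(** * Realizing types of sequences in an atomic model *)

Section Matching.
Context {L : Lang} (K : Structure L).
Hypothesis K_atomic : atomic_set K (fun _ => True).

(** Here [Q] stands for the complete type of an infinite sequence, possibly from another structure;
    only its restriction to the first [m] variables is compared with [s]. *)
Definition matches (Q : formula L -> Prop) (m : nat) (s : nat -> K) : Prop :=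
  forall phi, fv_below m phi -> (Q phi <-> sat K s phi).

Definition locally_realized (Q : formula L -> Prop) : Prop :=
  forall m, exists s, matches Q m s.

Definition realized_by (Q : formula L -> Prop) (h : nat -> K) : Prop :=
  forall phi, Q phi <-> sat K h phi.

Lemma complete_formula m (s : nat -> K) :
  exists psi, fv_below m psi /\ sat K s psi /\
    forall c, sat K c psi -> matches (fun phi => sat K s phi) m c.
Proof.
  destruct (K_atomic m s) as [psi [H1 [H2 H3]]]; [auto|].
  exists psi. split; [assumption|]. split; [assumption|].
  intros c Hc phi Hphi. symmetry. apply H3; assumption.
Qed.

Lemma realized_matches Q m h : realized_by Q h -> matches Q m h.
Proof. intros H phi _. apply H. Qed.

Lemma fv_below_ex m (psi : formula L) : fv_below (S m) psi -> fv_below m (FEx m psi).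
Proof. intros H x. simpl. intros [[h1 [h2|[]]]|[]]. specialize (H x h2). lia. Qed.

(** Homogeneity of atomic models: if [psi] isolates the restriction of [Q] to [m + 1] variables, its
    existential closure belongs to [Q] and is therefore true of [s]; any witness continues the
    match. *)
Lemma matches_extend1 Q m s :
  locally_realized Q -> matches Q m s -> exists d, matches Q (S m) (upd s m d).
Proof.
  intros HQ Hm. destruct (HQ (S m)) as [t Ht].
  destruct (complete_formula (S m) t) as [psi [H1 [H2 H3]]].
  assert (Hex : fv_below m (FEx m psi)) by (apply fv_below_ex, H1).
  assert (Hs : sat K s (FEx m psi)).
  { apply Hm, Ht; [assumption|apply fv_below_mono with m; [lia|assumption]|].
    apply sat_ex. exists (t m).
    apply (sat_agree K psi t); [|assumption].
    intros x _. unfold upd. decide_lt; congruence. }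
  apply sat_ex in Hs. destruct Hs as [d Hd].
  exists d. intros phi Hphi. rewrite (Ht phi Hphi). apply H3; assumption.
Qed.

(* A Rasiowa-Sikorski argument: conditions are finite partial realizations. *)
Lemma generic_realization Q (R : nat -> nat -> (nat -> K) -> Prop) :
  locally_realized Q ->
  (forall i m s s', (forall x, x < m -> s x = s' x) -> R i m s -> R i m s') ->
  (forall i m s, matches Q m s -> exists m' s', m <= m' /\
     (forall x, x < m -> s' x = s x) /\ matches Q m' s' /\ R i m' s') ->
  forall m s, matches Q m s ->
    exists h, realized_by Q h /\ (forall x, x < m -> h x = s x) /\
      forall i, exists m', R i m' h.
Proof.
  intros HQ HR Hdense m0 s0 H0.
  pose (cond := {p : nat * (nat -> K) | matches Q (fst p) (snd p)}).
  assert (Hstep : forall ip : nat * cond, exists p' : cond,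
     let p := proj1_sig (snd ip) in
     S (fst p) <= fst (proj1_sig p') /\
     (forall x, x < fst p -> snd (proj1_sig p') x = snd p x) /\
     exists m', m' <= fst (proj1_sig p') /\ R (fst ip) m' (snd (proj1_sig p'))).
  { intros [i [[m s] Hms]]. simpl in *.
    destruct (Hdense i m s Hms) as [m' [s' [H1 [H2 [H3 H4]]]]].
    (* One entry beyond what density provides is added, so that the lengths of the conditions tend
       to infinity and the limit is defined everywhere. *)
    destruct (matches_extend1 Q m' s' HQ H3) as [d Hd].
    unshelve eexists (exist _ (S m', upd s' m' d) _); [exact Hd|]. simpl.
    split; [lia|]. split.
    - intros x Hx. rewrite upd_other by lia. auto.
    - exists m'. split; [lia|]. apply HR with s'; [|assumption].
      intros x Hx. rewrite upd_other by lia. reflexivity. }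
  destruct (choice _ Hstep) as [next Hnext]. clear Hstep.
  pose (chain := fix chain i : cond := match i with
     | 0 => exist _ (m0, s0) H0
     | S i => next (i, chain i) end).
  pose (len := fun i => fst (proj1_sig (chain i))).
  pose (val := fun i => snd (proj1_sig (chain i))).
  assert (HS : forall i, S (len i) <= len (S i) /\
     (forall x, x < len i -> val (S i) x = val i x) /\
     exists m', m' <= len (S i) /\ R i m' (val (S i))).
  { intros i. exact (Hnext (i, chain i)). }
  assert (Hlen : forall i, m0 <= len i /\ i <= len i).
  { intros i. induction i as [|i IH].
    - unfold len. simpl. lia.
    - destruct (HS i) as [h _]. lia. }
  assert (Hmono : forall i j, i <= j -> len i <= len j /\
     forall x, x < len i -> val j x = val i x).
  { intros i j H. induction H as [|j H [IH1 IH2]]; [auto|].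
    destruct (HS j) as [h1 [h2 _]]. split; [lia|].
    intros x Hx. rewrite h2 by lia. auto. }
  pose (h := fun x => val (S x) x).
  assert (Hh : forall i x, x < len i -> h x = val i x).
  { intros i x Hx. unfold h. destruct (Nat.le_ge_cases (S x) i) as [H|H].
    - symmetry. apply Hmono; [assumption|]. destruct (Hlen (S x)). lia.
    - apply Hmono; assumption. }
  exists h. split; [|split].
  - intros phi. destruct (formula_fv_below phi) as [b Hb].
    assert (Hm : matches Q (len b) (val b)) by exact (proj2_sig (chain b)).
    assert (Hb' : fv_below (len b) phi).
    { apply fv_below_mono with b; [apply Hlen|assumption]. }
    rewrite (Hm phi Hb'). apply sat_agree_below with (len b); [assumption|].
    intros x Hx. symmetry. auto.
  - intros x Hx. apply (Hh 0). exact Hx.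
  - intros i. destruct (HS i) as [_ [_ [m' [h1 h2]]]]. exists m'.
    apply HR with (val (S i)); [|assumption].
    intros x Hx. symmetry. apply Hh. lia.
Qed.

Lemma extend_realization Q m s :
  locally_realized Q -> matches Q m s ->
  exists h, realized_by Q h /\ forall x, x < m -> h x = s x.
Proof.
  intros HQ Hm.
  destruct (generic_realization Q (fun _ _ _ => True) HQ) with (m := m) (s := s)
    as [h [H1 [H2 _]]]; auto.
  - intros _ m' s' H. exists m', s'. auto.
  - exists h. auto.
Qed.

(** A tuple of [K] is built entry by entry. The existential closure of the next isolating formula
    holds of the part already built, and elementarity of [e] shows that its witness, found in [K],
    has the isolated type. *)
Lemma locally_realized_in_extension (N : Structure L) (e : K -> N) (tau : nat -> N) :
  elementary_embedding K N e ->
  (forall m, exists psi, fv_below m psi /\ sat N tau psi /\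
     forall phi, fv_below m phi -> forall c, sat N c psi -> (sat N c phi <-> sat N tau phi)) ->
  locally_realized (fun phi => sat N tau phi).
Proof.
  intros He Hat m. induction m as [|m [s Hs]].
  - destruct (carrier_inhabited L K) as [d]. exists (fun _ => d). intros phi Hphi.
    rewrite (He phi). apply sat_agree_below with 0; [assumption|lia].
  - destruct (Hat (S m)) as [psi [H1 [H2 H3]]].
    assert (Hex : sat K s (FEx m psi)).
    { apply Hs; [apply fv_below_ex, H1|].
      apply sat_ex. exists (tau m). apply (sat_agree N psi tau); [|assumption].
      intros x _. unfold upd. decide_lt; congruence. }
    apply sat_ex in Hex. destruct Hex as [d Hd].
    exists (upd s m d). intros phi Hphi. rewrite (He phi).
    symmetry. apply H3; [assumption|]. apply He, Hd.
Qed.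

End Matching.

Arguments matches {L} K Q m s.
Arguments locally_realized {L} K Q.
Arguments realized_by {L} K Q h.

(** * Types invariant over a finite tuple *)

Lemma prepend_assoc {A : Type} k m (a b s : nat -> A) :
  prepend (k + m) (prepend k a b) s = prepend k a (prepend m b s).
Proof.
  extensionality i. unfold prepend. decide_lt; try lia; try reflexivity.
  f_equal. lia.
Qed.

Section Schemes.
Context {L : Lang} (K : Structure L).
Hypothesis K_atomic : atomic_set K (fun _ => True).
Variables (k : nat) (a : nat -> K) (n : nat).

(* A nonrealized type over [K] in [n] variables, given by a realization [it_c] in an
   extension; [it_inv] says that it does not split over [a_0, ..., a_(k-1)]. *)
Record invariant_type := {
  it_N : Structure L;
  it_e : K -> it_N;
  it_c : nat -> it_N;
  it_elem : elementary_embedding K it_N it_e;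
  it_loc : forall u : nat -> K, locally_realized K
    (fun phi => sat it_N (prepend n it_c (fun i => it_e (u i))) phi);
  it_inv : forall m u u',
    matches K (fun phi => sat K (prepend k a u) phi) (k + m) (prepend k a u') ->
    forall phi, fv_below (n + m) phi ->
      (sat it_N (prepend n it_c (fun i => it_e (u i))) phi <->
       sat it_N (prepend n it_c (fun i => it_e (u' i))) phi);
  it_new : exists i, i < n /\ forall m, it_c i <> it_e m
}.

Definition holds (q : invariant_type) (u : nat -> K) (phi : formula L) : Prop :=
  sat (it_N q) (prepend n (it_c q) (fun i => it_e q (u i))) phi.

Variable q : invariant_type.

Lemma holds_agree u u' m phi :
  (forall i, i < m -> u i = u' i) -> fv_below (n + m) phi -> (holds q u phi <-> holds q u' phi).
Proof.
  intros H Hphi. apply sat_agree_below with (n + m); [assumption|].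
  intros x Hx. unfold prepend. decide_lt; [reflexivity|]. rewrite H by lia. reflexivity.
Qed.

Lemma holds_inv m u u' :
  matches K (fun phi => sat K (prepend k a u) phi) (k + m) (prepend k a u') ->
  forall phi, fv_below (n + m) phi -> (holds q u phi <-> holds q u' phi).
Proof. apply it_inv. Qed.

(** Permuting, repeating or dropping parameters of [q] carries a realization over [u] to one over
    [u'] without rebuilding it. *)
Lemma realized_rename u u' h (rho : nat -> nat) :
  realized_by K (holds q u) h ->
  (forall i, prepend n (it_c q) (fun i => it_e q (u' i)) i =
             prepend n (it_c q) (fun i => it_e q (u i)) (rho i)) ->
  realized_by K (holds q u') (fun i => h (rho i)).
Proof.
  intros Hh Hrho phi. destruct (rename_formula phi rho) as [phi' [H1 _]].
  rewrite <- (H1 K), <- (Hh phi'). unfold holds at 2. rewrite H1. unfold holds.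
  apply sat_agree. auto.
Qed.

Lemma elementary_injective (N : Structure L) (e : K -> N) x y :
  elementary_embedding K N e -> e x = e y -> x = y.
Proof.
  intros He H.
  apply (He (FEq (var 0) (var 1)) (fun i => match i with 0 => x | _ => y end)).
  exact H.
Qed.

Lemma realized_eq u h i j :
  realized_by K (holds q u) h -> (h (n + i) = h (n + j) <-> u i = u j).
Proof.
  intros Hh. specialize (Hh (FEq (var (n + i)) (var (n + j)))). simpl in Hh.
  rewrite <- Hh. unfold holds. simpl. rewrite !prepend_ge. split; [|congruence].
  apply elementary_injective, it_elem.
Qed.

Lemma realized_params u h : realized_by K (holds q u) h ->
  realized_by K (fun phi => sat K u phi) (fun i => h (n + i)).
Proof.
  intros Hh phi. destruct (rename_formula phi (fun i => n + i)) as [phi' [H1 _]].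
  change (sat K u phi <-> sat K (fun i => h (n + i)) phi).
  rewrite <- (H1 K), <- (Hh phi'). unfold holds. rewrite H1, (it_elem q phi u).
  apply sat_agree. intros x _. rewrite prepend_ge. reflexivity.
Qed.

Lemma realized_new u h :
  realized_by K (holds q u) h -> exists i, i < n /\ forall j, h i <> h (n + j).
Proof.
  intros Hh. destruct (it_new q) as [i [Hi Hn]]. exists i. split; [assumption|].
  intros j H. apply (Hn (u j)).
  assert (Hs : sat K h (FEq (var i) (var (n + j)))) by exact H.
  apply Hh in Hs. unfold holds in Hs. simpl in Hs.
  rewrite prepend_lt, prepend_ge in Hs by assumption. exact Hs.
Qed.

(** * Procedures reading a real off the type of a tuple *)

Definition default : K := epsilon (carrier_inhabited L K) (fun _ => True).

Definition entry (l : list K) (i : nat) : K := nth i l default.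

Definition code : Type := list (list K * list K).

Definition arity (w : code) : nat :=
  match w with
  | nil => n + k
  | cons (d, s) _ => k + (length s - n)
  end.

(* A code [w] assigns to each index [j] a set of formulas; a tuple [d] yields over a set
   [B] the real whose [j]-th bit tells whether [d] satisfies one of them with parameters
   from [B].  The empty code recovers a type from its realization and the tuple [a].  A
   code [(d, s) :: w] yields the bits which, in a generic realization of [q] extending
   the finite condition [s], may still become true in the real that [d] yields by [w]. *)
Fixpoint proc (w : code) (j : formula L * formula L) : formula L -> Prop :=
  match w with
  | nil => fun theta => forall (M : Structure L) s, sat M s theta <->
      (sat M (fun i => s (n + i)) (snd j) /\
       sat M (fun i => s (if i <? n then i else k + i)) (fst j))
  | cons (d, s) w' => fun chi => exists phi, proc w' j phi /\
      forall u, sat K (prepend k a u) chi -> exists h,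
        (forall i, i < length s -> h i = entry s i) /\
        realized_by K (holds q u) h /\
        sat K (prepend (arity w') (entry d) (fun y => h (length s + y))) phi
  end.

Lemma nth_map_seq (s : nat -> K) m i : i < m -> entry (map s (seq 0 m)) i = s i.
Proof.
  intros H. unfold entry. rewrite nth_indep with (d' := s 0).
  - rewrite map_nth, seq_nth; auto.
  - rewrite length_map, length_seq. exact H.
Qed.

(** This is the definability of forcing. The list [kappa] enumerates the smaller model inside [K],
    and [I] selects the set that witnesses come from. Whether the condition can be extended to make
    [phi] true depends only on the type over [a] of the finitely many parameters involved, since [q]
    does not split over [a]; that type is isolated by some [chi]. *)
Lemma possible_bits_computed (kappa : nat -> K) (I : nat -> Prop) w d m s j :
  n <= m ->
  (exists h, realized_by K (holds q kappa) h /\ (forall x, x < m -> h x = s x) /\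
     exists phi, proc w j phi /\ exists v, (forall y, I (v y)) /\
       sat K (prepend (arity w) (entry d) (fun y => h (n + v y))) phi)
  <->
  (exists chi, proc ((d, map s (seq 0 m)) :: w) j chi /\
     exists v, (forall y, I (v y)) /\
       sat K (prepend (arity ((d, map s (seq 0 m)) :: w)) (prepend k a kappa)
                (fun y => kappa (v y))) chi).
Proof.
  intros Hnm. simpl arity. rewrite length_map, length_seq.
  remember (m - n) as M eqn:HM. assert (Hm : m = n + M) by lia. clear HM Hnm. subst m.
  split.
  - intros [h [Hh [Hs [phi [Hphi [v [Hv Hsat]]]]]]].
    destruct (formula_fv_below phi) as [t Ht].
    (* The parameters already bound by the condition are followed by the witnesses, the order that
       [proc] expects. *)
    pose (u := prepend M kappa (fun y => kappa (v y))).
    destruct (complete_formula K K_atomic (k + (M + t)) (prepend k a u))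
      as [chi [Hc1 [Hc2 Hc3]]].
    exists chi. split.
    + simpl. exists phi. split; [assumption|]. rewrite length_map, length_seq.
      intros u' Hu'. specialize (Hc3 _ Hu').
      pose (h1 := fun i => h (if i <? n + M then i else n + v (i - (n + M)))).
      assert (H1 : realized_by K (holds q u) h1).
      { apply (realized_rename kappa u h); [assumption|]. intros i. unfold u, prepend.
        decide_lt; try lia; try reflexivity. do 2 f_equal.
        replace (i - (n + M)) with (i - n - M) by lia. lia. }
      assert (H2 : matches K (holds q u') (n + (M + t)) h1).
      { intros phi0 H0. rewrite <- (H1 phi0). symmetry.
        apply (holds_inv (M + t)); assumption. }
      destruct (extend_realization K K_atomic _ _ _ (it_loc q u') H2) as [h' [H3 H4]].
      exists h'. split; [|split; [assumption|]].
      * intros i Hi. rewrite nth_map_seq, H4, <- Hs by lia. unfold h1. decide_lt; [|lia].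
        reflexivity.
      * revert Hsat. apply sat_agree_below with t; [assumption|].
        intros x Hx. unfold prepend. decide_lt; [reflexivity|].
        rewrite H4 by lia. unfold h1. decide_lt; [lia|]. do 3 f_equal. lia.
    + exists v. split; [assumption|]. rewrite prepend_assoc. exact Hc2.
  - intros [chi [[phi [Hphi Hall]] [v [Hv Hsat]]]].
    rewrite prepend_assoc in Hsat. set (u := prepend M kappa (fun y => kappa (v y))) in *.
    destruct (Hall u Hsat) as [h [Hs [Hh Hd]]]. clear Hall Hsat.
    rewrite length_map, length_seq in Hs, Hd.
    destruct (formula_fv_below phi) as [t Ht].
    (* The realization [h] covers only the parameters [u]. Appending all of [kappa] after the
       entries that matter gives a realization over the whole smaller model; [rho] then reads the
       first [M] parameters in place and every other one from the appended copy. *)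
    pose (u2 := prepend (M + t) u kappa).
    assert (Hm : matches K (holds q u2) (n + (M + t)) h).
    { intros phi0 H0. rewrite <- (Hh phi0). apply holds_agree with (M + t); [|assumption].
      intros i Hi. unfold u2. rewrite prepend_lt by assumption. reflexivity. }
    destruct (extend_realization K K_atomic _ _ _ (it_loc q u2) Hm) as [h2 [H2 H3]].
    pose (rho := fun i => if i <? n + M then i else n + (M + t + (i - n))).
    assert (Hrho : forall i, exists i', rho (n + i) = n + i' /\ u2 i' = kappa i).
    { intros i. unfold rho. destruct (Nat.ltb_spec (n + i) (n + M)).
      - exists i. split; [reflexivity|]. unfold u2, u. rewrite !prepend_lt by lia. reflexivity.
      - exists (M + t + i). split; [lia|]. unfold u2. apply prepend_ge. }
    exists (fun i => h2 (rho i)). split; [|split].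
    + apply (realized_rename u2 kappa h2); [assumption|]. intros i.
      destruct (Nat.lt_ge_cases i n) as [Hi|Hi].
      * unfold rho. destruct (Nat.ltb_spec i (n + M)); [|lia].
        rewrite !prepend_lt by assumption. reflexivity.
      * destruct (Hrho (i - n)) as [i' [E1 E2]].
        replace i with (n + (i - n)) by lia. rewrite E1, !prepend_ge, E2. reflexivity.
    + intros x Hx. unfold rho. destruct (Nat.ltb_spec x (n + M)); [|lia].
      rewrite H3 by lia. rewrite Hs by assumption. apply nth_map_seq. assumption.
    + exists phi. split; [assumption|]. exists v. split; [assumption|].
      revert Hd. apply sat_agree_below with t; [assumption|].
      intros x Hx. unfold prepend. decide_lt; [reflexivity|].
      destruct (Hrho (v (x - arity w))) as [i' [E1 E2]]. rewrite E1.
      rewrite <- (H3 (n + M + (x - arity w))) by lia.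
      rewrite <- Nat.add_assoc. apply (realized_eq u2); [assumption|].
      rewrite E2. unfold u2, u. rewrite prepend_lt, prepend_ge by lia. reflexivity.
Qed.

Hypothesis K_countable : countable_type K.

Lemma countable_code : countable_type code.
Proof.
  apply countable_list, countable_prod; apply countable_list, K_countable.
Qed.

(* If some condition could not be extended to one that spoils the computation of [r] from
   [d] by [w], then that condition and [d] would provide a code computing [r] from a tuple
   of parameters. *)
Lemma omitting_realization (kappa : nat -> K) (I : nat -> nat -> Prop)
    (r : formula L * formula L -> Prop) :
  (forall i w, ~ forall j, r j <-> exists chi, proc w j chi /\
     exists v, (forall y, I i (v y)) /\
       sat K (prepend (arity w) (prepend k a kappa) (fun y => kappa (v y))) chi) ->
  exists h, realized_by K (holds q kappa) h /\
    forall i w d, ~ forall j, r j <-> exists phi, proc w j phi /\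
      exists v, (forall y, I i (v y)) /\
        sat K (prepend (arity w) (entry d) (fun y => h (n + v y))) phi.
Proof.
  intros Hno.
  destruct (countable_prod countable_nat
    (countable_prod countable_code (countable_list K_countable))) as [num Hnum].
  (* A condition defeats the computation numbered [z] in one of two ways: it already makes true a
     bit outside [r], with all witnesses at positions below [m], or it prevents a bit of [r] from
     ever becoming true. *)
  pose (R := fun z m s => forall i w d, num (i, (w, d)) = z ->
    (exists j, ~ r j /\ exists phi, proc w j phi /\ exists t, fv_below t phi /\
       exists v, (forall y, I i (v y)) /\ (forall y, y < t -> n + v y < m) /\
         sat K (prepend (arity w) (entry d) (fun y => s (n + v y))) phi) \/
    (exists j, r j /\ ~ exists h, realized_by K (holds q kappa) h /\
       (forall x, x < m -> h x = s x) /\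
       exists phi, proc w j phi /\ exists v, (forall y, I i (v y)) /\
         sat K (prepend (arity w) (entry d) (fun y => h (n + v y))) phi)).
  destruct (generic_realization K K_atomic (holds q kappa) R) with (m := 0)
    (s := fun _ : nat => default) as [h [H1 [_ H3]]].
  - apply it_loc.
  - intros z m s s' Hss HR i w d Hz. specialize (HR i w d Hz).
    destruct HR as [[j [Hj [phi [Hphi [t [Ht [v [Hv [Hb Hsat]]]]]]]]]|[j [Hj Hn]]].
    + left. exists j. split; [assumption|]. exists phi. split; [assumption|].
      exists t. split; [assumption|]. exists v. do 2 (split; [assumption|]).
      revert Hsat. apply sat_agree_below with t; [assumption|].
      intros x Hx. unfold prepend. decide_lt; [reflexivity|]. symmetry. apply Hss, Hb. lia.
    + right. exists j. split; [assumption|]. intros [h [H1 [H2 H3]]]. apply Hn.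
      exists h. split; [assumption|]. split; [|assumption].
      intros x Hx. rewrite Hss by assumption. auto.
  - intros z m s Hms.
    destruct (extend_realization K K_atomic _ _ _ (it_loc q kappa) Hms) as [h0 [H0 Hs]].
    (* A condition recorded in a code must contain all [n] entries of the realization of [q], hence
       the lengthening by [n]. *)
    pose (m1 := m + n). apply NNPP. intros Hdense.
    assert (Hd : forall m' h, m1 <= m' -> realized_by K (holds q kappa) h ->
              (forall x, x < m1 -> h x = h0 x) -> ~ R z m' h).
    { intros m' h Hm' Hh Hx HR. apply Hdense. exists m', h. split; [lia|].
      split; [|split; [apply realized_matches|]; assumption].
      intros x Hxm. rewrite Hx by lia. auto. }
    destruct (classic (exists i w d, num (i, (w, d)) = z)) as [[i [w [d Hz]]]|Hz].
    2: { apply (Hd m1 h0); auto. intros i w d Hz'. exfalso. eauto 6. }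
    assert (Hzu : forall i' w' d', num (i', (w', d')) = z -> i' = i /\ w' = w /\ d' = d).
    { intros i' w' d' Hz'. rewrite <- Hz in Hz'. apply Hnum in Hz'.
      injection Hz' as -> -> ->. auto. }
    apply (Hno i ((d, map h0 (seq 0 m1)) :: w)). intros j.
    rewrite <- possible_bits_computed by lia. split.
    + intros Hj. apply NNPP. intros Hn. apply (Hd m1 h0); auto.
      intros i' w' d' Hz'. destruct (Hzu i' w' d' Hz') as [-> [-> ->]].
      right. exists j. auto.
    + intros [h [Hh [Hx [phi [Hphi [v [Hv Hsat]]]]]]]. apply NNPP. intros Hj.
      destruct (formula_fv_below phi) as [t Ht].
      destruct (bounded_below (fun y => n + v y) t) as [b Hb].
      apply (Hd (m1 + b) h); [lia|assumption|assumption|].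
      intros i' w' d' Hz'. destruct (Hzu i' w' d' Hz') as [-> [-> ->]].
      left. exists j. split; [assumption|]. exists phi. split; [assumption|].
      exists t. split; [assumption|]. exists v. split; [assumption|]. split; [|assumption].
      intros y Hy. specialize (Hb y Hy). simpl in Hb. lia.
  - intros phi Hphi. destruct (it_loc q kappa 0) as [s Hs]. rewrite (Hs phi Hphi).
    apply sat_agree_below with 0; [assumption|lia].
  - exists h. split; [assumption|]. intros i w d Hr.
    destruct (H3 (num (i, (w, d)))) as [m Hm].
    destruct (Hm i w d eq_refl)
      as [[j [Hj [phi [Hphi [t [Ht [v [Hv [Hb Hsat]]]]]]]]]|[j [Hj Hn]]].
    + apply Hj, Hr. eauto.
    + apply Hn. exists h. split; [assumption|]. split; [reflexivity|]. apply Hr, Hj.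
Qed.

End Schemes.

(** * Elementary diagrams on subsets of a fixed type *)

Section Diagrams.
Context {L : Lang} (K : Structure L).
Hypothesis K_atomic : atomic_set K (fun _ => True).
Variables (k : nat) (a : nat -> K) (X : Type) (aD : nat -> X).

Definition into (D : X -> Prop) (s : nat -> X) : Prop := forall i, D (s i).

Lemma into_upd D s x d : into D s -> D d -> into D (upd s x d).
Proof. intros Hs Hd i. apply (upd_all D); assumption. Qed.

Lemma into_prepend D m s s' : into D s -> into D s' -> into D (prepend m s s').
Proof. intros Hs Hs' i. apply (prepend_all D); auto. Qed.

(* [Delta] is the satisfaction relation of a structure with universe [D], all of whose
   finite tuples have types realized in [K], and in which [aD] has the type of [a]; it is
   meaningful only on assignments into [D].  Renamings appear in [dg_loc] because a single
   tuple of [K] has to serve for several assignments. *)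
Record diagram (D : X -> Prop) (Delta : formula L -> (nat -> X) -> Prop) : Prop := {
  dg_base : into D aD;
  dg_agree : forall phi s s', into D s -> into D s' ->
    (forall x, free_in x phi -> s x = s' x) -> Delta phi s -> Delta phi s';
  dg_loc : forall s, into D s -> forall m, exists t : nat -> K,
    forall (rho : nat -> nat) phi, (forall x, free_in x phi -> rho x < m) ->
      (Delta phi (fun i => s (rho i)) <-> sat K (fun i => t (rho i)) phi);
  dg_eq : forall s, into D s -> forall i j, Delta (FEq (var i) (var j)) s <-> s i = s j;
  dg_all : forall s, into D s -> forall x phi,
    Delta (FAll x phi) s <-> forall d, D d -> Delta phi (upd s x d);
  dg_tuple : matches K (fun phi => Delta phi aD) k a
}.

Lemma diagram_ext D (Delta Delta' : formula L -> (nat -> X) -> Prop) :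
  (forall phi s, into D s -> (Delta phi s <-> Delta' phi s)) ->
  diagram D Delta -> diagram D Delta'.
Proof.
  intros E [H1 H2 H3 H4 H5 H6]. split.
  - assumption.
  - intros phi s s' Hs Hs' H. rewrite <- !E by assumption. eauto.
  - intros s Hs m. destruct (H3 s Hs m) as [t Ht]. exists t. intros rho phi Hphi.
    rewrite <- E by (intros i; apply Hs). auto.
  - intros s Hs i j. rewrite <- E by assumption. auto.
  - intros s Hs x phi. rewrite <- E, H5 by assumption.
    split; intros H d Hd; (apply E; [apply into_upd; assumption|auto]).
  - intros phi Hphi. rewrite <- E by assumption. auto.
Qed.

Section OneDiagram.
Variables (D : X -> Prop) (Delta : formula L -> (nat -> X) -> Prop).
Hypothesis HD : diagram D Delta.

Lemma dg_agree_iff phi s s' : into D s -> into D s' ->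
  (forall x, free_in x phi -> s x = s' x) -> (Delta phi s <-> Delta phi s').
Proof.
  intros Hs Hs' H. split; apply (dg_agree _ _ HD); auto. intros x Hx. symmetry. auto.
Qed.

Lemma dg_locally_realized s : into D s -> locally_realized K (fun phi => Delta phi s).
Proof.
  intros Hs m. destruct (dg_loc _ _ HD s Hs m) as [t Ht]. exists t.
  intros phi Hphi. exact (Ht (fun i => i) phi Hphi).
Qed.

Lemma dg_rename phi rho : exists phi',
  (forall M s, sat M s phi' <-> sat M (fun i => s (rho i)) phi) /\
  (forall s, into D s -> (Delta phi' s <-> Delta phi (fun i => s (rho i)))).
Proof.
  destruct (rename_formula phi rho) as [phi' [H1 H2]]. exists phi'.
  split; [assumption|]. intros s Hs.
  destruct (formula_fv_below phi) as [b Hb]. destruct (bounded_below rho b) as [m Hm].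
  destruct (dg_loc _ _ HD s Hs m) as [t Ht].
  rewrite (Ht rho) by auto. rewrite <- H1. apply (Ht (fun i => i)).
  intros x Hx. destruct (H2 x Hx) as [y [Hy ->]]. auto.
Qed.

Lemma dg_imp phi psi s : into D s ->
  (Delta (FImp phi psi) s <-> (Delta phi s -> Delta psi s)).
Proof.
  intros Hs. destruct (formula_fv_below (FImp phi psi)) as [b Hb].
  destruct (dg_locally_realized s Hs b) as [t Ht].
  rewrite (Ht _ Hb), (Ht phi), (Ht psi); [simpl; tauto| |];
    intros x Hx; apply Hb; simpl; auto.
Qed.

Lemma dg_bot s : into D s -> ~ Delta FBot s.
Proof.
  intros Hs H. destruct (dg_locally_realized s Hs 0) as [t Ht].
  apply (Ht FBot) in H; [exact H|]. intros x [].
Qed.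

Lemma dg_ex x phi s : into D s ->
  (Delta (FEx x phi) s <-> exists d, D d /\ Delta phi (upd s x d)).
Proof.
  intros Hs. unfold FEx, FNot. rewrite dg_imp, (dg_all _ _ HD) by assumption. split.
  - intros H. apply NNPP. intros Hn. apply (dg_bot s Hs), H. intros d Hd.
    apply dg_imp; [apply into_upd; assumption|]. intros H'. exfalso. eauto.
  - intros [d [Hd H]] H'. exfalso. specialize (H' d Hd).
    assert (Hu : into D (upd s x d)) by (apply into_upd; assumption).
    rewrite (dg_imp _ _ _ Hu) in H'. exact (dg_bot _ Hu (H' H)).
Qed.

(** The converse of local realization: once the first [m] entries agree in type, every further entry
    of a tuple of [K] has a counterpart in [D]. It makes each diagram realize the same finite types
    over [aD] as [K] does over [a]. *)
Lemma dg_realize s m (t : nat -> K) : into D s ->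
  matches K (fun phi => Delta phi s) m t ->
  forall l, exists s', into D s' /\ (forall x, x < m -> s' x = s x) /\
    matches K (fun phi => Delta phi s') (m + l) t.
Proof.
  intros Hs Hm l. induction l as [|l [s' [H1 [H2 H3]]]].
  - exists s. rewrite Nat.add_0_r. auto.
  - destruct (complete_formula K K_atomic (S (m + l)) t) as [psi [Hp1 [Hp2 Hp3]]].
    assert (Hex : Delta (FEx (m + l) psi) s').
    { apply H3; [apply fv_below_ex, Hp1|]. apply sat_ex. exists (t (m + l)).
      revert Hp2. apply sat_agree. intros x _. unfold upd. decide_lt; congruence. }
    apply dg_ex in Hex; [|assumption]. destruct Hex as [d [Hd Hpsi]].
    assert (Hu : into D (upd s' (m + l) d)) by (apply into_upd; assumption).
    exists (upd s' (m + l) d). split; [assumption|]. split.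
    + intros x Hx. rewrite upd_other by lia. auto.
    + replace (m + S l) with (S (m + l)) by lia.
      destruct (dg_locally_realized _ Hu (S (m + l))) as [t' Ht'].
      intros phi Hphi. rewrite (Ht' phi Hphi). symmetry. apply Hp3; [|assumption].
      apply Ht'; assumption.
Qed.

(** A countable atomic model is prime: an enumeration of [D], preceded by the tuple [aD], is locally
    realized in [K], and a realization starting with [a] is the embedding. *)
Lemma dg_embeds : countable_subset D ->
  exists g : X -> K, (forall i, i < k -> g (aD i) = a i) /\
    forall phi s, into D s -> (Delta phi s <-> sat K (fun i => g (s i)) phi).
Proof.
  intros Hc. pose proof (dg_base _ _ HD) as Hbase.
  destruct (countable_subset_enum D (aD 0) (Hbase 0) Hc) as [de [Hde Hsurj]].
  pose (s0 := prepend k aD de).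
  assert (Hs0 : into D s0) by (apply into_prepend; auto).
  assert (Hm : matches K (fun phi => Delta phi s0) k a).
  { intros phi Hphi. rewrite <- (dg_tuple _ _ HD phi Hphi). apply dg_agree_iff; auto.
    intros x Hx. apply prepend_lt. auto. }
  destruct (extend_realization K K_atomic _ _ _ (dg_locally_realized s0 Hs0) Hm)
    as [h [H1 H2]].
  destruct (choice (fun x i => D x -> x = de i)) as [idx Hidx].
  { intros x. destruct (classic (D x)) as [h'|h'].
    - destruct (Hsurj x h') as [i Hi]. eauto.
    - exists 0. contradiction. }
  exists (fun x => h (k + idx x)). split.
  - intros i Hi. rewrite <- H2 by assumption.
    apply (H1 (FEq (var (k + idx (aD i))) (var i))).
    apply (dg_eq _ _ HD); [assumption|]. unfold s0.
    rewrite prepend_ge, prepend_lt by assumption. symmetry. apply Hidx, Hbase.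
  - intros phi s Hs. destruct (dg_rename phi (fun i => k + idx (s i))) as [phi' [E1 E2]].
    rewrite <- (E1 K h), <- (H1 phi'), E2 by assumption. apply dg_agree_iff.
    + assumption.
    + intros i. apply Hs0.
    + intros x _. unfold s0. rewrite prepend_ge. apply Hidx, Hs.
Qed.

(** * The structure presented by a diagram *)

Definition place {A : Type} {r : nat} (args : Fin.t r -> A) (y : A) : nat -> A :=
  fun i => match lt_dec i r with
           | left h => args (Fin.of_nat_lt h)
           | right _ => y
           end.

Definition index {r : nat} (j : Fin.t r) : nat := proj1_sig (Fin.to_nat j).

Lemma index_lt {r} (j : Fin.t r) : index j < r.
Proof. exact (proj2_sig (Fin.to_nat j)). Qed.

Lemma place_index {A : Type} {r : nat} (args : Fin.t r -> A) y j :
  place args y (index j) = args j.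
Proof.
  unfold place. destruct (lt_dec (index j) r) as [h|h].
  - f_equal. rewrite <- (Fin.of_nat_to_nat_inv j). apply Fin.of_nat_ext.
  - destruct h. apply index_lt.
Qed.

Lemma place_ge {A : Type} {r : nat} (args : Fin.t r -> A) y i : r <= i -> place args y i = y.
Proof. intros H. unfold place. destruct (lt_dec i r); [lia|reflexivity]. Qed.

Lemma place_into {r : nat} (args : Fin.t r -> X) y :
  (forall j, D (args j)) -> D y -> into D (place args y).
Proof. intros H1 H2 i. unfold place. destruct (lt_dec i r); auto. Qed.

Definition fun_graph (f : Fsym L) : formula L :=
  FEq (app f (fun j => var (index j))) (var (farity L f)).

Definition universe : Type := {x : X | D x}.

Lemma universe_inhabited : inhabited universe.
Proof. constructor. exists (aD 0). apply (dg_base _ _ HD). Qed.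

(** A diagram knows a function symbol only through the truth of its graph, so the value has to be
    chosen by [epsilon]. The entry [aD 0] fills the irrelevant positions of an assignment. *)
Definition diagram_structure : Structure L := {|
  carrier := universe;
  carrier_inhabited := universe_inhabited;
  funs := fun f args => epsilon universe_inhabited (fun y =>
    Delta (fun_graph f) (place (fun j => proj1_sig (args j)) (proj1_sig y)));
  rels := fun r args => Delta (FRel r (fun j => var (index j)))
    (place (fun j => proj1_sig (args j)) (aD 0))
|}.

Lemma free_in_fun_graph f x :
  free_in x (fun_graph f) -> (exists j : Fin.t (farity L f), x = index j) \/ x = farity L f.
Proof. simpl. intros [[j H]|H]; [left; exists j|right]; congruence. Qed.

Lemma funs_graph f (args : Fin.t (farity L f) -> universe) :
  Delta (fun_graph f) (place (fun j => proj1_sig (args j))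
                             (proj1_sig (funs diagram_structure f args))).
Proof.
  simpl. apply epsilon_spec.
  pose (s := place (fun j => proj1_sig (args j)) (aD 0)).
  assert (Hs : into D s).
  { apply place_into; [intros j; apply proj2_sig|apply (dg_base _ _ HD)]. }
  assert (Hex : Delta (FEx (farity L f) (fun_graph f)) s).
  { destruct (formula_fv_below (FEx (farity L f) (fun_graph f))) as [b Hb].
    destruct (dg_locally_realized s Hs b) as [t Ht]. apply (Ht _ Hb). apply sat_ex.
    exists (funs K f (fun j => t (index j))). simpl. rewrite upd_same. f_equal.
    extensionality j. apply upd_other. pose proof (index_lt j). lia. }
  apply dg_ex in Hex; [|assumption]. destruct Hex as [d [Hd H]].
  exists (exist _ d Hd). simpl. revert H. apply (dg_agree _ _ HD).
  - apply into_upd; assumption.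
  - apply place_into; [intros j; apply proj2_sig|assumption].
  - intros x Hx. apply free_in_fun_graph in Hx. destruct Hx as [[j ->]| ->].
    + rewrite place_index, upd_other by (pose proof (index_lt j); lia).
      apply (place_index (fun j => proj1_sig (args j))).
    + rewrite place_ge by lia. apply upd_same.
Qed.

Lemma proj1_into (s : nat -> diagram_structure) : into D (fun i => proj1_sig (s i)).
Proof. intros i. apply proj2_sig. Qed.

(** Terms are not evaluated by [Delta], so the value is named by a variable [m]. Both the values of
    the arguments and the value of the term are transported to one tuple of [K], where the equation
    can be computed. *)
Lemma diagram_eval (t : term L) : forall (s : nat -> diagram_structure) m,
  s m = eval diagram_structure s t -> Delta (FEq t (var m)) (fun i => proj1_sig (s i)).
Proof.
  induction t as [x|f args IH]; intros s m Hm.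
  - apply (dg_eq _ _ HD); [apply proj1_into|]. simpl in Hm. congruence.
  - destruct (formula_fv_below (FEq (app f args) (var m))) as [b Hb].
    (* From position [b] on, beyond all variables of the equation, [w] stores the values of the
       arguments. *)
    pose (w := prepend b s
      (place (fun j => eval diagram_structure s (args j)) (s m))).
    assert (Hw : forall x, x < b -> w x = s x) by (intros; apply prepend_lt; assumption).
    assert (Hargs : forall j, w (b + index j) = eval diagram_structure s (args j)).
    { intros j. unfold w. rewrite prepend_ge.
      apply (place_index (fun j => eval diagram_structure s (args j))). }
    pose (wv := fun i => proj1_sig (w i)).
    assert (Hwv : into D wv) by apply proj1_into.
    destruct (dg_loc _ _ HD wv Hwv (b + farity L f)) as [t Ht].
    assert (HK : forall j, eval K t (args j) = t (b + index j)).
    { intros j. apply (Ht (fun i => i) (FEq (args j) (var (b + index j)))).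
      - simpl. intros x [Hx|<-]; [|pose proof (index_lt j); lia].
        assert (x < b) by (apply Hb; simpl; eauto). lia.
      - apply IH. rewrite Hargs. apply eval_agree. intros x Hx. symmetry.
        apply Hw, Hb. simpl. eauto. }
    pose (rho := fun i => if i <? farity L f then b + i else m).
    assert (Hmb : m < b) by (apply Hb; simpl; auto).
    assert (Hf : Delta (fun_graph f) (fun i => wv (rho i))).
    { pose proof (funs_graph f (fun j => eval diagram_structure s (args j))) as H.
      revert H. apply (dg_agree _ _ HD).
      - apply place_into; intros; apply proj2_sig.
      - intros i. apply Hwv.
      - intros x Hx. apply free_in_fun_graph in Hx. destruct Hx as [[j ->]| ->].
        + rewrite place_index. unfold rho, wv.
          destruct (Nat.ltb_spec (index j) (farity L f)) as [h|h].
          * rewrite Hargs. reflexivity.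
          * pose proof (index_lt j). lia.
        + rewrite place_ge by lia. unfold rho, wv. rewrite Nat.ltb_irrefl, Hw, Hm by assumption.
          reflexivity. }
    apply Ht in Hf.
    + simpl in Hf. unfold rho in Hf at 2. rewrite Nat.ltb_irrefl in Hf.
      assert (HD' : Delta (FEq (app f args) (var m)) wv).
      { apply (Ht (fun i => i)).
        - intros x Hx. specialize (Hb x Hx). lia.
        - simpl. rewrite <- Hf. f_equal. extensionality j.
          etransitivity; [apply HK|]. unfold rho.
          destruct (Nat.ltb_spec (index j) (farity L f)) as [h|h]; [reflexivity|].
          pose proof (index_lt j). lia. }
      revert HD'. apply (dg_agree _ _ HD); [assumption|apply proj1_into|].
      intros x Hx. unfold wv. rewrite Hw by auto. reflexivity.
    + intros x Hx. apply free_in_fun_graph in Hx. unfold rho. destruct Hx as [[j ->]| ->].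
      * destruct (Nat.ltb_spec (index j) (farity L f)); lia.
      * rewrite Nat.ltb_irrefl. lia.
Qed.

Lemma diagram_sat (phi : formula L) : forall s : nat -> diagram_structure,
  sat diagram_structure s phi <-> Delta phi (fun i => proj1_sig (s i)).
Proof.
  induction phi as [t u|r args| |phi IH1 psi IH2|x phi IH]; intros s.
  - destruct (formula_fv_below (FEq t u)) as [b Hb].
    pose (w := prepend b s (fun i => match i with
      | 0 => eval diagram_structure s t | _ => eval diagram_structure s u end)).
    assert (Hw : forall x, x < b -> s x = w x)
      by (intros; symmetry; apply prepend_lt; assumption).
    assert (H0 : w b = eval diagram_structure s t).
    { unfold w, prepend. rewrite Nat.ltb_irrefl, Nat.sub_diag. reflexivity. }
    assert (H1 : w (b + 1) = eval diagram_structure s u).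
    { unfold w. rewrite prepend_ge. reflexivity. }
    pose (wv := fun i => proj1_sig (w i)).
    assert (Hwv : into D wv) by apply proj1_into.
    destruct (dg_locally_realized wv Hwv (b + 2)) as [t' Ht].
    assert (E0 : eval K t' t = t' b).
    { apply (Ht (FEq t (var b))).
      - simpl. intros x [Hx|<-]; [|lia]. assert (x < b) by (apply Hb; simpl; auto). lia.
      - apply diagram_eval. rewrite H0. apply eval_agree. intros x Hx.
        apply Hw, Hb. simpl. auto. }
    assert (E1 : eval K t' u = t' (b + 1)).
    { apply (Ht (FEq u (var (b + 1)))).
      - simpl. intros x [Hx|<-]; [|lia]. assert (x < b) by (apply Hb; simpl; auto). lia.
      - apply diagram_eval. rewrite H1. apply eval_agree. intros x Hx.
        apply Hw, Hb. simpl. auto. }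
    rewrite (dg_agree_iff (FEq t u) _ wv (proj1_into s) Hwv).
    2: { intros x Hx. unfold wv. rewrite Hw by auto. reflexivity. }
    rewrite (Ht (FEq t u)) by (apply fv_below_mono with b; [lia|assumption]).
    simpl. rewrite E0, E1, <- H0, <- H1.
    change (w b = w (b + 1) <-> sat K t' (FEq (var b) (var (b + 1)))).
    assert (Hb' : fv_below (b + 2) (@FEq L (var b) (var (b + 1))))
      by (simpl; intros x [<-|<-]; lia).
    rewrite <- (Ht _ Hb'), (dg_eq _ _ HD) by assumption. unfold wv. split; [congruence|].
    intros H. destruct (w b) as [x hx], (w (b + 1)) as [y hy]. simpl in H.
    subst y. f_equal. apply proof_irrelevance.
  - destruct (formula_fv_below (FRel r args)) as [b Hb].
    pose (w := prepend b s
      (place (fun j => eval diagram_structure s (args j)) (s 0))).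
    assert (Hw : forall x, x < b -> s x = w x)
      by (intros; symmetry; apply prepend_lt; assumption).
    assert (Hargs : forall j, w (b + index j) = eval diagram_structure s (args j)).
    { intros j. unfold w. rewrite prepend_ge.
      apply (place_index (fun j => eval diagram_structure s (args j))). }
    pose (wv := fun i => proj1_sig (w i)).
    assert (Hwv : into D wv) by apply proj1_into.
    destruct (dg_loc _ _ HD wv Hwv (b + rarity L r)) as [t Ht].
    assert (HK : forall j, eval K t (args j) = t (b + index j)).
    { intros j. apply (Ht (fun i => i) (FEq (args j) (var (b + index j)))).
      - simpl. intros x [Hx|<-]; [|pose proof (index_lt j); lia].
        assert (x < b) by (apply Hb; simpl; eauto). lia.
      - apply diagram_eval. rewrite Hargs. apply eval_agree. intros x Hx.
        apply Hw, Hb. simpl. eauto. }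
    rewrite (dg_agree_iff (FRel r args) _ wv (proj1_into s) Hwv).
    2: { intros x Hx. unfold wv. rewrite Hw by auto. reflexivity. }
    rewrite (Ht (fun i => i) (FRel r args)) by (intros x Hx; specialize (Hb x Hx); lia).
    simpl. replace (fun j => eval K (fun i => t i) (args j))
      with (fun j : Fin.t (rarity L r) => t (b + index j)).
    2: { extensionality j. symmetry. apply HK. }
    change (Delta (FRel r (fun j => var (index j)))
        (place (fun j => proj1_sig (eval diagram_structure s (args j))) (aD 0)) <->
      sat K (fun i => t (b + i)) (FRel r (fun j => var (index j)))).
    rewrite <- (Ht (fun i => b + i)).
    2: { simpl. intros x [j <-]. pose proof (index_lt j). lia. }
    apply dg_agree_iff.
    + apply place_into; [intros j; apply proj2_sig|apply (dg_base _ _ HD)].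
    + intros i. apply Hwv.
    + simpl. intros x [j <-]. unfold wv. rewrite Hargs.
      apply (place_index (fun j => proj1_sig (eval diagram_structure s (args j)))).
  - simpl. split; [contradiction|]. apply dg_bot, proj1_into.
  - rewrite dg_imp by apply proj1_into. rewrite <- IH1, <- IH2. reflexivity.
  - rewrite (dg_all _ _ HD) by apply proj1_into. simpl. split.
    + intros H d Hd. specialize (H (exist _ d Hd)). apply IH in H.
      rewrite (upd_comp (@proj1_sig X D)) in H. exact H.
    + intros H m. apply IH. rewrite (upd_comp (@proj1_sig X D)). apply H, proj2_sig.
Qed.

Lemma diagram_atomic_model (T : formula L -> Prop) :
  is_model T K -> (forall phi, T phi -> sentence phi) ->
  atomic_model T diagram_structure.
Proof.
  intros HT Hsent. split.
  - intros phi Hphi s. apply diagram_sat.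
    destruct (dg_locally_realized _ (proj1_into s) 0) as [t Ht].
    apply Ht; [|apply HT, Hphi]. intros x Hx. destruct (Hsent phi Hphi x Hx).
  - intros l s _. destruct (dg_locally_realized _ (proj1_into s) l) as [t Ht].
    destruct (complete_formula K K_atomic l t) as [psi [H1 [H2 H3]]].
    exists psi. split; [assumption|]. split; [apply diagram_sat, Ht; assumption|].
    intros phi Hphi c Hc. rewrite !diagram_sat. rewrite diagram_sat in Hc.
    destruct (dg_locally_realized _ (proj1_into c) l) as [t' Ht'].
    rewrite (Ht phi Hphi), (Ht' phi Hphi). symmetry. apply H3; [|assumption].
    apply Ht'; assumption.
Qed.

End OneDiagram.

Lemma diagram_copy (j : K -> X) (e : X -> K) :
  (forall x, e (j x) = x) -> (forall i, exists x, aD i = j x) ->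
  matches K (fun phi => sat K (fun i => e (aD i)) phi) k a ->
  diagram (fun y => exists x, y = j x) (fun phi s => sat K (fun i => e (s i)) phi).
Proof.
  intros He Ha Hm.
  assert (Hj : forall y, (exists x, y = j x) -> j (e y) = y).
  { intros y [x ->]. rewrite He. reflexivity. }
  split.
  - exact Ha.
  - intros phi s s' _ _ H. apply sat_agree. intros x Hx. rewrite H by assumption. reflexivity.
  - intros s Hs m. exists (fun i => e (s i)). reflexivity.
  - intros s Hs i i'. simpl. split; [|congruence]. intros H.
    rewrite <- (Hj _ (Hs i)), <- (Hj _ (Hs i')), H. reflexivity.
  - intros s Hs x phi. simpl. split.
    + intros H d _. rewrite upd_comp. apply H.
    + intros H m. specialize (H (j m)). rewrite upd_comp, He in H. apply H. eauto.
  - exact Hm.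
Qed.

End Diagrams.

(** * Models of size aleph_1 by Zorn's lemma *)

Section Construction.
Context {L : Lang} (K : Structure L).
Hypothesis K_atomic : atomic_set K (fun _ => True).
Hypothesis K_countable : countable_type K.
Variables (k : nat) (a : nat -> K) (n : nat) (q : invariant_type K k a n).
Variables (X : Type) (aD : nat -> X).
Hypothesis X_uncountable : ~ countable_subset (fun _ : X => True).
Variable r : formula L * formula L -> Prop.
Hypothesis r_new : forall w (d : list K), ~ forall j, r j <->
  exists chi, proc K k a n q w j chi /\
    exists s : nat -> K, sat K (prepend (arity K k n w) (entry K d) s) chi.

Definition computes (Delta : formula L -> (nat -> X) -> Prop) (B : X -> Prop)
    (w : code K) (d : nat -> X) (j : formula L * formula L) : Prop :=
  exists chi, proc K k a n q w j chi /\
    exists s, into X B s /\ Delta chi (prepend (arity K k n w) d s).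

(** This says that [c] realizes [q] over [B], although [B] need not lie in [K]: parameters [s] are
    replaced by any [u] in [K] having over [a] the type of [s] over [aD]. Invariance of [q] makes
    the choice of [u] immaterial. *)
Definition follows (Delta : formula L -> (nat -> X) -> Prop) (B : X -> Prop)
    (c : nat -> X) : Prop :=
  forall s u, into X B s ->
    realized_by K (fun phi => Delta phi (prepend k aD s)) (prepend k a u) ->
    forall phi, holds K k a n q u phi <-> Delta phi (prepend n c s).

Record piece := {
  pD : X -> Prop;
  pDelta : formula L -> (nat -> X) -> Prop;
  pE : X -> Prop;
  pG : X -> X -> Prop
}.

(* The sets [pG x], for [x] in [pE], are earlier stages of the construction: over each of
   them [q] has been realized, and [r] must never be computed. *)
Record good (P : piece) : Prop := {
  good_diagram : diagram K k a X aD (pD P) (pDelta P);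
  good_sub : forall x, pE P x -> pD P x;
  good_self : forall x, pE P x -> pG P x x;
  good_in : forall x, pE P x -> forall y, pG P x y -> pD P y;
  good_countable : forall x, pE P x -> countable_subset (pG P x);
  good_stage : forall x, pE P x -> diagram K k a X aD (pG P x) (pDelta P);
  good_follows : forall x, pE P x ->
    exists c, into X (pD P) c /\ follows (pDelta P) (pG P x) c;
  good_omits : forall x, pE P x -> forall w d, into X (pD P) d ->
    ~ forall j, r j <-> computes (pDelta P) (pG P x) w d j;
  good_chain : forall x y, pE P x -> pE P y ->
    (forall z, pG P x z -> pG P y z) \/ (forall z, pG P y z -> pG P x z);
  good_covers : countable_subset (pD P) \/ (forall x, pD P x -> pE P x)
}.

(** All old points must have received a stage in [P'], which is more than inclusion of universes.
    The relation is thus not reflexive in general, and [extends] adds equality. *)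
Definition below (P P' : piece) : Prop :=
  (forall x, pD P x -> pE P' x) /\
  (forall x, pE P x -> pG P' x = pG P x) /\
  (forall phi s, into X (pD P) s -> (pDelta P phi s <-> pDelta P' phi s)).

Lemma into_mono (B D : X -> Prop) s : (forall x, B x -> D x) -> into X B s -> into X D s.
Proof. intros H Hs i. apply H, Hs. Qed.

Lemma follows_ext D (Delta Delta' : formula L -> (nat -> X) -> Prop) B c :
  (forall phi s, into X D s -> (Delta phi s <-> Delta' phi s)) ->
  into X D aD -> into X D c -> (forall x, B x -> D x) ->
  follows Delta B c -> follows Delta' B c.
Proof.
  intros HE Ha Hc HB H s u Hs Hu phi.
  pose proof (into_mono B D s HB Hs) as HsD.
  rewrite <- HE by (apply into_prepend; assumption). apply H; [assumption|].
  intros phi0. rewrite HE by (apply into_prepend; assumption). apply Hu.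
Qed.

Lemma realized_reindex (u h : nat -> K) (v : nat -> nat) phi :
  realized_by K (fun phi => sat K u phi) h ->
  (sat K (fun i => u (v i)) phi <-> sat K (fun i => h (v i)) phi).
Proof.
  intros H. destruct (rename_formula phi v) as [phi' [H1 _]].
  rewrite <- !H1. apply H.
Qed.

(** The larger model is [K] itself, relabelled by points of [X]. The old universe is first copied
    into [K] by [g] only to serve as parameters; its final position in [K] is given by the parameter
    part of the generic realization [h]. *)
Lemma extend_piece (P : piece) : good P -> countable_subset (pD P) ->
  exists P', good P' /\ below P P' /\ exists x, pD P' x /\ ~ pD P x.
Proof.
  intros HP Hc. pose proof (good_diagram P HP) as HD.
  pose proof (dg_base _ _ _ _ _ _ _ HD) as Ha.
  set (D := pD P) in *. set (Delta := pDelta P) in *.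
  destruct (dg_embeds K K_atomic k a X aD D Delta HD Hc) as [g [Hga Hg]].
  destruct (countable_subset_enum D (aD 0) (Ha 0) Hc) as [de [Hde Hsurj]].
  destruct (choice (fun x i => D x -> x = de i)) as [idx Hidx].
  { intros x. destruct (classic (D x)) as [h'|h'].
    - destruct (Hsurj x h') as [i Hi]. eauto.
    - exists 0. contradiction. }
  assert (Hs_de : forall s, into X D s -> s = fun i => de (idx (s i))).
  { intros s Hs. extensionality i. apply Hidx, Hs. }
  pose (kappa := fun i => g (de i)).
  (* Points without a stage receive the whole present universe as theirs; [q] is now realized over
     it. *)
  pose (G' := fun x => if excluded_middle_informative (pE P x) then pG P x else D).
  assert (HG'D : forall x y, G' x y -> D y).
  { intros x y. unfold G'. destruct (excluded_middle_informative (pE P x)); auto.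
    apply (good_in P HP). assumption. }
  pose (d0 := prepend k aD de).
  assert (Hd0 : into X D d0) by (apply into_prepend; assumption).
  assert (Hgd0 : (fun i => g (d0 i)) = prepend k a kappa).
  { extensionality i. unfold d0, prepend. decide_lt; auto. }
  destruct (omitting_realization K K_atomic k a n q K_countable kappa
    (fun i y => G' (de i) (de y)) r) as [h [Hh Hom]].
  { intros i w Hr.
    assert (Hr' : forall j, r j <-> computes Delta (G' (de i)) w d0 j).
    { intros j. rewrite Hr. split.
      - intros [chi [H1 [v [H2 H3]]]]. exists chi. split; [assumption|].
        exists (fun y => de (v y)). split; [exact H2|]. apply Hg.
        + apply into_prepend; [assumption|]. intros y. apply Hde.
        + rewrite prepend_comp, Hgd0. exact H3.
      - intros [chi [H1 [s [H2 H3]]]]. exists chi. split; [assumption|].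
        pose proof (into_mono _ D s (HG'D (de i)) H2) as H2'.
        exists (fun y => idx (s y)). split.
        + intros y. rewrite <- Hidx by apply H2'. apply H2.
        + apply Hg in H3; [|apply into_prepend; assumption].
          rewrite prepend_comp, Hgd0, (Hs_de s H2') in H3. exact H3. }
    unfold G' in Hr'. destruct (excluded_middle_informative (pE P (de i))) as [HE|HE].
    { exact (good_omits P HP (de i) HE w d0 Hd0 Hr'). }
    (* For the new stage [D], computing [r] over [D] is the same as computing it over all of [K]:
       [g] carries witnesses into [K], and [dg_realize] brings them back. The hypothesis [r_new]
       rules this out. *)
    set (l := arity K k n w) in *.
    apply (r_new w (map (prepend k a kappa) (seq 0 l))). intros j. rewrite Hr'.
    fold l.
    assert (Hent : forall s, prepend l (entry K (map (prepend k a kappa) (seq 0 l))) s =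
                             prepend l (prepend k a kappa) s).
    { intros s. extensionality x. unfold prepend at 1 3. decide_lt; [|reflexivity].
      apply nth_map_seq. assumption. }
    split.
    - intros [chi [H1 [s [H2 H3]]]]. exists chi. split; [assumption|].
      exists (fun y => g (s y)). rewrite Hent, <- Hgd0, <- prepend_comp.
      apply Hg in H3; [exact H3|]. apply into_prepend; assumption.
    - intros [chi [H1 [s H3]]]. exists chi. split; [assumption|].
      rewrite Hent, <- Hgd0 in H3.
      destruct (formula_fv_below chi) as [b Hb].
      destruct (dg_realize K K_atomic k a X aD D Delta HD d0 l
        (prepend l (fun i => g (d0 i)) s) Hd0) with (l := b) as [s' [E1 [E2 E3]]].
      + intros phi Hphi. rewrite Hg by assumption. apply sat_agree_below with l; [assumption|].
        intros x Hx. rewrite prepend_lt by assumption. reflexivity.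
      + exists (fun y => s' (l + y)). split; [intros y; apply E1|].
        apply E3 in H3; [|apply fv_below_mono with b; [lia|assumption]].
        change (arity K k n w) with l.
        replace (prepend l d0 (fun y => s' (l + y))) with s'; [exact H3|].
        extensionality x. unfold prepend. decide_lt; [auto|]. f_equal. lia. }
  assert (Hkappa : forall i i', kappa i = kappa i' <-> de i = de i').
  { intros i i'. split; [|unfold kappa; congruence]. intros H.
    pose (s := fun y => match y with 0 => de i | _ => de i' end).
    assert (Hs : into X D s) by (intros [|y]; apply Hde).
    apply (dg_eq _ _ _ _ _ _ _ HD s Hs 0 1). apply Hg; [assumption|]. exact H. }
  assert (Hpar : forall i i', h (n + i) = h (n + i') <-> de i = de i').
  { intros i i'. rewrite (realized_eq K k a n q kappa h i i' Hh). apply Hkappa. }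
  destruct K_countable as [nu Hnu].
  (* Labels for the elements of [K] outside the copy of [D] are taken from the complement of [D],
     which is uncountable because [D] is countable. *)
  destruct (nat_embeds_in_uncountable (fun x => ~ D x)) as [fresh [Hf1 Hf2]].
  { intros H. apply X_uncountable.
    apply countable_subset_mono with (fun x => exists b : bool, if b then D x else ~ D x).
    - intros x _. destruct (classic (D x)); [exists true|exists false]; assumption.
    - apply countable_subset_union; [|intros [|]; assumption].
      exists (fun b : bool => if b then 0 else 1). intros [|] [|]; congruence. }
  assert (Hj : exists j : K -> X, forall m,
    (forall i, m = h (n + i) -> j m = de i) /\
    ((forall i, m <> h (n + i)) -> j m = fresh (nu m))).
  { apply (choice (fun m y => (forall i, m = h (n + i) -> y = de i) /\
      ((forall i, m <> h (n + i)) -> y = fresh (nu m)))).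
    intros m. destruct (classic (exists i, m = h (n + i))) as [[i Hi]|Hn].
    - exists (de i). split.
      + intros i' Hi'. apply Hpar. congruence.
      + intros H. destruct (H i Hi).
    - exists (fresh (nu m)). split; [|reflexivity].
      intros i Hi. destruct Hn. eauto. }
  destruct Hj as [j Hj].
  assert (Hjh : forall i, j (h (n + i)) = de i) by (intros i; apply Hj; reflexivity).
  assert (Hjinj : forall m m', j m = j m' -> m = m').
  { assert (Hcase : forall m, (exists i, m = h (n + i)) \/ (forall i, m <> h (n + i))).
    { intros m. destruct (classic (exists i, m = h (n + i))) as [H|H]; [auto|].
      right. intros i Hi. eauto. }
    intros m m' H. destruct (Hcase m) as [[i ->]|Hm], (Hcase m') as [[i' ->]|Hm'].
    - rewrite !Hjh in H. apply Hpar, H.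
    - destruct (Hf1 (nu m')). rewrite <- (proj2 (Hj m') Hm'), <- H, Hjh. apply Hde.
    - destruct (Hf1 (nu m)). rewrite <- (proj2 (Hj m) Hm), H, Hjh. apply Hde.
    - rewrite (proj2 (Hj m) Hm), (proj2 (Hj m') Hm') in H. apply Hnu, Hf2, H. }
  destruct (choice (fun x m => (exists m', x = j m') -> x = j m)) as [e He'].
  { intros x. destruct (classic (exists m', x = j m')) as [[m Hm]|H].
    - eauto.
    - exists (default K). contradiction. }
  assert (He : forall m, e (j m) = m).
  { intros m. symmetry. apply Hjinj, He'. eauto. }
  assert (Hede : forall i, e (de i) = h (n + i)).
  { intros i. rewrite <- Hjh. apply He. }
  pose (D' := fun y => exists m, y = j m).
  pose (Delta' := fun (phi : formula L) (s : nat -> X) => sat K (fun i => e (s i)) phi).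
  assert (HDD' : forall x, D x -> D' x).
  { intros x Hx. exists (h (n + idx x)). rewrite Hjh. auto. }
  assert (Hparams := realized_params K k a n q kappa h Hh).
  assert (HDelta : forall phi s, into X D s -> (Delta phi s <-> Delta' phi s)).
  { intros phi s Hs. rewrite Hg by assumption. rewrite (Hs_de s Hs). unfold Delta'.
    replace (fun i => e (de (idx (s i)))) with (fun i => h (n + idx (s i))).
    - exact (realized_reindex kappa _ (fun i => idx (s i)) phi Hparams).
    - extensionality i. symmetry. apply Hede. }
  exists {| pD := D'; pDelta := Delta'; pE := D; pG := G' |}.
  split; [split; simpl|split; [split; [|split]; simpl|]].
  - apply diagram_copy; [exact He|intros i; apply HDD', Ha|].
    intros phi Hphi. change (Delta' phi aD <-> sat K a phi).
    rewrite <- HDelta by assumption. apply (dg_tuple _ _ _ _ _ _ _ HD phi Hphi).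
  - assumption.
  - intros x Hx. unfold G'. destruct (excluded_middle_informative (pE P x)); [|assumption].
    apply (good_self P HP). assumption.
  - intros x Hx y Hy. apply HDD', (HG'D x y Hy).
  - intros x Hx. unfold G'. destruct (excluded_middle_informative (pE P x)); [|assumption].
    apply (good_countable P HP). assumption.
  - intros x Hx. apply diagram_ext with Delta.
    + intros phi s Hs. apply HDelta. apply into_mono with (G' x); [apply HG'D|assumption].
    + unfold G'. destruct (excluded_middle_informative (pE P x)); [|assumption].
      apply (good_stage P HP). assumption.
  - intros x Hx. unfold G'. destruct (excluded_middle_informative (pE P x)) as [HE|HE].
    + destruct (good_follows P HP x HE) as [c [Hc1 Hc2]]. exists c. split.
      * apply into_mono with D; assumption.
      * apply follows_ext with D Delta; try assumption. apply (good_in P HP), HE.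
    + exists (fun i => j (h i)). split; [intros i; exists (h i); reflexivity|].
      intros s u Hs Hu phi. rewrite (Hs_de s Hs) in *.
      set (v := fun y => idx (s y)) in *.
      (* Invariance over [a] replaces the arbitrary [u] by the parameters for which [h] is known to
         realize [q]. *)
      transitivity (holds K k a n q (fun y => kappa (v y)) phi).
      * destruct (formula_fv_below phi) as [b Hb].
        apply holds_inv with b; [|apply fv_below_mono with b; [lia|assumption]].
        intros psi _. rewrite <- (Hu psi), <- HDelta, Hg, prepend_comp.
        -- apply sat_agree. intros x0 _. unfold prepend. decide_lt; auto.
        -- apply into_prepend; [assumption|intros y; apply Hde].
        -- apply into_prepend; [assumption|intros y; apply Hde].
      * etransitivity.
        -- apply (realized_rename K k a n q kappa (fun y => kappa (v y)) h
             (fun i => if i <? n then i else n + v (i - n)) Hh).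
           intros i. unfold prepend. decide_lt; try lia; [reflexivity|].
           do 2 f_equal. lia.
        -- unfold Delta'. apply sat_agree. intros x0 _. unfold prepend.
           decide_lt; rewrite ?He; [reflexivity|]. symmetry. apply Hede.
  - intros x Hx w d Hd Hr. rewrite (Hidx x Hx) in Hr. set (i := idx x) in *.
    set (l := arity K k n w) in *.
    apply (Hom i w (map (fun y => e (d y)) (seq 0 l))). intros j0. rewrite Hr. fold l.
    assert (Hent : forall s, prepend l (entry K (map (fun y => e (d y)) (seq 0 l))) s =
                             prepend l (fun y => e (d y)) s).
    { intros s. extensionality y. unfold prepend. decide_lt; [|reflexivity].
      apply (nth_map_seq K (fun y => e (d y))). assumption. }
    split.
    + intros [chi [H1 [s [H2 H3]]]]. exists chi. split; [assumption|].
      pose proof (into_mono _ D s (HG'D (de i)) H2) as H2'.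
      exists (fun y => idx (s y)). split.
      * intros y. rewrite <- Hidx by apply H2'. apply H2.
      * rewrite Hent. unfold Delta' in H3. rewrite prepend_comp in H3.
        replace (fun y => h (n + idx (s y))) with (fun y => e (s y)); [exact H3|].
        extensionality y. rewrite <- Hede. f_equal. apply Hidx, H2'.
    + intros [chi [H1 [v [H2 H3]]]]. exists chi. split; [assumption|].
      exists (fun y => de (v y)). split; [exact H2|]. unfold Delta'. rewrite Hent in H3.
      rewrite prepend_comp. replace (fun y => e (de (v y))) with (fun y => h (n + v y));
        [exact H3|]. extensionality y. symmetry. apply Hede.
  - intros x y Hx Hy. unfold G'. destruct (excluded_middle_informative (pE P x)) as [H1|H1],
      (excluded_middle_informative (pE P y)) as [H2|H2].
    + apply (good_chain P HP); assumption.
    + left. apply (good_in P HP). assumption.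
    + right. apply (good_in P HP). assumption.
    + left. auto.
  - left. apply countable_subset_range. exists nu. assumption.
  - auto.
  - intros x Hx. unfold G'. destruct (excluded_middle_informative (pE P x)); [reflexivity|].
    contradiction.
  - exact HDelta.
  - destruct (realized_new K k a n q kappa h Hh) as [i [_ Hi]].
    exists (j (h i)). split; [exists (h i); reflexivity|].
    intros H. apply Hidx in H. rewrite <- Hjh in H. exact (Hi _ (Hjinj _ _ H)).
Qed.

Definition extends (P P' : piece) : Prop := P = P' \/ below P P'.

Lemma extends_props P P' : good P -> good P' -> extends P P' ->
  (forall x, pD P x -> pD P' x) /\
  (forall x, pE P x -> pE P' x) /\
  (forall x, pE P x -> pG P' x = pG P x) /\
  (forall phi s, into X (pD P) s -> (pDelta P phi s <-> pDelta P' phi s)).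
Proof.
  intros HP HP' [<-|[H1 [H2 H3]]]; [firstorder|].
  repeat split; auto.
  - intros x Hx. apply (good_sub P' HP'), H1, Hx.
  - intros x Hx. apply H1, (good_sub P HP), Hx.
  - apply H3; assumption.
  - apply H3; assumption.
Qed.

Lemma below_trans P P' P'' : good P -> good P' ->
  below P P' -> below P' P'' -> below P P''.
Proof.
  intros HP HP' [H1 [H2 H3]] [H1' [H2' H3']]. split; [|split].
  - intros x Hx. apply H1', (good_sub P' HP'), H1, Hx.
  - intros x Hx. rewrite <- H2 by assumption. apply H2', H1, (good_sub P HP), Hx.
  - intros phi s Hs. rewrite H3 by assumption. apply H3'.
    intros i. apply (good_sub P' HP'), H1, Hs.
Qed.

(** * Unions of chains without a last piece *)

Section Union.
Variable C : piece -> Prop.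
Hypothesis C_good : forall P, C P -> good P.
Hypothesis C_total : forall P P', C P -> C P' -> extends P P' \/ extends P' P.
Hypothesis C_unbounded : forall P, C P -> exists P', C P' /\ below P P'.
Hypothesis C_inhabited : exists P, C P.

(** An assignment into the union may meet infinitely many pieces, so [pDelta] compares it on free
    variables with an assignment into a single piece. Every point counts as staged, because each
    piece lies below another one. *)
Definition union_piece : piece := {|
  pD := fun x => exists P, C P /\ pD P x;
  pDelta := fun phi s => exists P, C P /\ exists s', into X (pD P) s' /\
    (forall x, free_in x phi -> s x = s' x) /\ pDelta P phi s';
  pE := fun x => exists P, C P /\ pD P x;
  pG := fun x y => exists P, C P /\ pE P x /\ pG P x y
|}.

Lemma C_directed P P' : C P -> C P' ->
  exists P'', C P'' /\ extends P P'' /\ extends P' P''.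
Proof.
  intros H H'. destruct (C_total P P' H H') as [h|h].
  - exists P'. unfold extends. auto.
  - exists P. unfold extends. auto.
Qed.

Lemma union_common s m : into X (pD union_piece) s ->
  exists P, C P /\ forall i, i < m -> pD P (s i).
Proof.
  intros Hs. induction m as [|m [P [HP Hm]]].
  - destruct C_inhabited as [P HP]. exists P. split; [assumption|]. intros; lia.
  - destruct (Hs m) as [P' [HP' Hm']].
    destruct (C_directed P P' HP HP') as [P'' [HP'' [h h']]].
    exists P''. split; [assumption|]. intros i Hi.
    destruct (Nat.eq_dec i m) as [->|Hne].
    + apply (extends_props P' P'' (C_good _ HP') (C_good _ HP'') h'), Hm'.
    + apply (extends_props P P'' (C_good _ HP) (C_good _ HP'') h), Hm. lia.
Qed.

Lemma union_restrict P s m : C P -> (forall i, i < m -> pD P (s i)) ->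
  exists s', into X (pD P) s' /\ forall i, i < m -> s' i = s i.
Proof.
  intros HP Hs. exists (prepend m s aD). split.
  - intros i. apply (prepend_all (pD P) m s aD); [assumption|].
    apply (dg_base _ _ _ _ _ _ _ (good_diagram P (C_good P HP))).
  - intros i Hi. apply prepend_lt, Hi.
Qed.

Lemma union_Delta P phi s : C P -> into X (pD P) s ->
  (pDelta P phi s <-> pDelta union_piece phi s).
Proof.
  intros HP Hs. split.
  - intros H. exists P. split; [assumption|]. exists s. auto.
  - intros [P1 [HP1 [s1 [Hs1 [E H]]]]].
    destruct (C_directed P P1 HP HP1) as [P2 [HP2 [h h1]]].
    destruct (extends_props P P2 (C_good _ HP) (C_good _ HP2) h) as [HD [_ [_ HDel]]].
    destruct (extends_props P1 P2 (C_good _ HP1) (C_good _ HP2) h1) as [HD1 [_ [_ HDel1]]].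
    apply HDel; [assumption|]. apply HDel1 in H; [|assumption]. revert H.
    apply (dg_agree _ _ _ _ _ _ _ (good_diagram P2 (C_good _ HP2))).
    + intros i. auto.
    + intros i. auto.
    + intros x Hx. symmetry. auto.
Qed.

Lemma union_agree phi s s' : (forall x, free_in x phi -> s x = s' x) ->
  pDelta union_piece phi s -> pDelta union_piece phi s'.
Proof.
  intros E [P [HP [s1 [Hs1 [E1 H]]]]]. exists P. split; [assumption|].
  exists s1. split; [assumption|]. split; [|assumption].
  intros x Hx. rewrite <- E by assumption. auto.
Qed.

Lemma union_agree_iff phi s s' : (forall x, free_in x phi -> s x = s' x) ->
  (pDelta union_piece phi s <-> pDelta union_piece phi s').
Proof.
  intros E. split; apply union_agree; [assumption|]. intros x Hx. symmetry. auto.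
Qed.

Lemma union_covered x : pD union_piece x -> exists P, C P /\ pE P x.
Proof.
  intros [P [HP Hx]]. destruct (C_unbounded P HP) as [P' [HP' [H _]]].
  exists P'. auto.
Qed.

Lemma union_G P x : C P -> pE P x -> pG union_piece x = pG P x.
Proof.
  intros HP Hx. extensionality y. apply propositional_extensionality.
  split; [|intros H; exists P; auto].
  intros [P1 [HP1 [Hx1 H]]]. destruct (C_directed P P1 HP HP1) as [P2 [HP2 [h h1]]].
  destruct (extends_props P P2 (C_good _ HP) (C_good _ HP2) h) as [_ [_ [HG _]]].
  destruct (extends_props P1 P2 (C_good _ HP1) (C_good _ HP2) h1) as [_ [_ [HG1 _]]].
  rewrite <- HG, HG1 by assumption. exact H.
Qed.

Lemma union_diagram : diagram K k a X aD (pD union_piece) (pDelta union_piece).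
Proof.
  destruct C_inhabited as [P0 HP0].
  pose proof (good_diagram P0 (C_good P0 HP0)) as HD0. split.
  - intros i. exists P0. split; [assumption|]. apply (dg_base _ _ _ _ _ _ _ HD0).
  - intros phi s s' _ _. apply union_agree.
  - intros s Hs m. destruct (union_common s m Hs) as [P [HP Hm]].
    destruct (union_restrict P s m HP Hm) as [s1 [Hs1 E]].
    destruct (dg_loc _ _ _ _ _ _ _ (good_diagram P (C_good P HP)) s1 Hs1 m) as [t Ht].
    exists t. intros rho phi Hphi. rewrite <- (Ht rho phi Hphi).
    rewrite (union_Delta P) by (assumption || intros i; apply Hs1).
    apply union_agree_iff. intros x Hx. rewrite E; auto.
  - intros s Hs i j. destruct (union_common s (S (i + j)) Hs) as [P [HP Hm]].
    destruct (union_restrict P s _ HP Hm) as [s1 [Hs1 E]].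
    rewrite (union_agree_iff _ s s1).
    2: { simpl. intros x [<-|<-]; symmetry; apply E; lia. }
    rewrite <- (union_Delta P) by assumption.
    rewrite (dg_eq _ _ _ _ _ _ _ (good_diagram P (C_good P HP))) by assumption.
    rewrite !E by lia. reflexivity.
  - intros s Hs x phi. destruct (formula_fv_below (FAll x phi)) as [b Hb].
    destruct (union_common s b Hs) as [P [HP Hm]].
    destruct (union_restrict P s _ HP Hm) as [s1 [Hs1 E]].
    assert (Hupd : forall d, pDelta union_piece phi (upd s x d) <->
                             pDelta union_piece phi (upd s1 x d)).
    { intros d. apply union_agree_iff. intros y Hy. unfold upd. decide_lt; [reflexivity|].
      symmetry. apply E, Hb. simpl. auto. }
    rewrite (union_agree_iff _ s s1) by (intros y Hy; symmetry; auto).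
    split.
    + intros H d [P1 [HP1 Hd]]. apply Hupd.
      destruct (C_directed P P1 HP HP1) as [P2 [HP2 [h h1]]].
      destruct (extends_props P P2 (C_good _ HP) (C_good _ HP2) h) as [HD _].
      destruct (extends_props P1 P2 (C_good _ HP1) (C_good _ HP2) h1) as [HD1 _].
      assert (Hs2 : into X (pD P2) s1) by (intros i; auto).
      rewrite <- (union_Delta P2) in H by assumption.
      rewrite <- (union_Delta P2) by (auto; apply into_upd; auto).
      apply (dg_all _ _ _ _ _ _ _ (good_diagram P2 (C_good _ HP2))); auto.
    + intros H. rewrite <- (union_Delta P) by assumption.
      apply (dg_all _ _ _ _ _ _ _ (good_diagram P (C_good _ HP))); [assumption|].
      intros d Hd. rewrite (union_Delta P) by (auto; apply into_upd; auto).
      apply Hupd, H. exists P. auto.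
  - intros phi Hphi. rewrite <- (union_Delta P0).
    + apply (dg_tuple _ _ _ _ _ _ _ HD0 phi Hphi).
    + assumption.
    + apply (dg_base _ _ _ _ _ _ _ HD0).
Qed.

Lemma union_good : good union_piece.
Proof.
  assert (Hsub : forall P, C P -> forall x, pD P x -> pD union_piece x).
  { intros P HP x Hx. exists P. auto. }
  assert (HDel : forall P, C P -> forall phi s, into X (pD P) s ->
    (pDelta P phi s <-> pDelta union_piece phi s)).
  { intros P HP phi s. apply union_Delta, HP. }
  split.
  - apply union_diagram.
  - auto.
  - intros x Hx. destruct (union_covered x Hx) as [P [HP HE]].
    rewrite (union_G P x HP HE). apply (good_self P (C_good P HP)), HE.
  - intros x Hx y. destruct (union_covered x Hx) as [P [HP HE]].
    rewrite (union_G P x HP HE). intros Hy. apply (Hsub P HP).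
    apply (good_in P (C_good P HP) x HE y Hy).
  - intros x Hx. destruct (union_covered x Hx) as [P [HP HE]].
    rewrite (union_G P x HP HE). apply (good_countable P (C_good P HP)), HE.
  - intros x Hx. destruct (union_covered x Hx) as [P [HP HE]].
    rewrite (union_G P x HP HE). pose proof (C_good P HP) as HgP.
    apply diagram_ext with (pDelta P); [|apply (good_stage P HgP), HE].
    intros phi s Hs. apply HDel; [assumption|].
    apply into_mono with (pG P x); [apply (good_in P HgP x HE)|assumption].
  - intros x Hx. destruct (union_covered x Hx) as [P [HP HE]].
    rewrite (union_G P x HP HE). pose proof (C_good P HP) as HgP.
    destruct (good_follows P HgP x HE) as [c [Hc1 Hc2]]. exists c. split.
    + apply into_mono with (pD P); [apply Hsub, HP|assumption].
    + apply follows_ext with (pD P) (pDelta P); try assumption.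
      * intros phi s. apply HDel, HP.
      * apply (dg_base _ _ _ _ _ _ _ (good_diagram P HgP)).
      * apply (good_in P HgP x HE).
  - intros x Hx w d Hd Hr. destruct (union_covered x Hx) as [P [HP HE]].
    set (l := arity K k n w) in *.
    destruct (union_common d l Hd) as [P1 [HP1 Hd1]].
    destruct (C_directed P P1 HP HP1) as [P2 [HP2 [h h1]]].
    destruct (extends_props P P2 (C_good _ HP) (C_good _ HP2) h) as [_ [HE2 _]].
    destruct (extends_props P1 P2 (C_good _ HP1) (C_good _ HP2) h1) as [HD1 _].
    rewrite (union_G P2 x HP2 (HE2 x HE)) in Hr.
    destruct (union_restrict P2 d l HP2) as [d' [Hd' E]]; [auto|].
    apply (good_omits P2 (C_good _ HP2) x (HE2 x HE) w d' Hd').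
    intros j. rewrite Hr. unfold computes. fold l.
    assert (Hsame : forall s, prepend l d s = prepend l d' s).
    { intros s. extensionality i. unfold prepend. decide_lt; [|reflexivity].
      symmetry. auto. }
    assert (Hin : forall chi s, into X (pG P2 x) s ->
      (pDelta P2 chi (prepend l d' s) <-> pDelta union_piece chi (prepend l d s))).
    { intros chi s Hs. rewrite Hsame. apply HDel; [assumption|].
      apply into_prepend; [assumption|].
      apply into_mono with (pG P2 x); [|assumption].
      apply (good_in P2 (C_good _ HP2) x (HE2 x HE)). }
    split; intros [chi [H1 [s [H2 H3]]]]; exists chi; (split; [assumption|]);
      exists s; (split; [assumption|]); apply Hin; assumption.
  - intros x y Hx Hy.
    destruct (union_covered x Hx) as [P [HP HE]], (union_covered y Hy) as [P1 [HP1 HE1]].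
    destruct (C_directed P P1 HP HP1) as [P2 [HP2 [h h1]]].
    destruct (extends_props P P2 (C_good _ HP) (C_good _ HP2) h) as [_ [H2 _]].
    destruct (extends_props P1 P2 (C_good _ HP1) (C_good _ HP2) h1) as [_ [H3 _]].
    rewrite (union_G P2 x HP2 (H2 x HE)), (union_G P2 y HP2 (H3 y HE1)).
    apply (good_chain P2 (C_good _ HP2)); auto.
  - right. auto.
Qed.

Lemma union_bound P : C P -> below P union_piece.
Proof.
  intros HP. split; [|split].
  - intros x Hx. exists P. auto.
  - intros x Hx. apply union_G; assumption.
  - intros phi s. apply union_Delta, HP.
Qed.

End Union.

(** A maximal piece with countable universe would be enlarged by [extend_piece], and the new point
    contradicts both alternatives of [extends] in the reverse direction. *)
Lemma maximal_piece P0 : good P0 ->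
  exists P, good P /\ ~ countable_subset (pD P).
Proof.
  intros HP0.
  destruct (@zorn_preorder {P : piece | good P} (exist _ P0 HP0)
    (fun P P' => extends (proj1_sig P) (proj1_sig P'))) as [[P HP] Hmax].
  - intros P. left. reflexivity.
  - intros [P HP] [P' HP'] [P'' HP'']. simpl. unfold extends.
    intros [<-|H] [<-|H']; auto. right. apply below_trans with P'; assumption.
  - intros A HA.
    (* A chain with a last element is bounded by it; only in the other case does every piece have
       one strictly above it, as the union requires. *)
    destruct (classic (exists P, A P /\ forall P', A P' -> extends (proj1_sig P') (proj1_sig P)))
      as [[P [_ H]]|Hn]; [exists P; assumption|].
    destruct (classic (exists P, A P)) as [Hne|He].
    2: { exists (exist _ P0 HP0). intros P HP. exfalso. eauto. }
    pose (C := fun P => exists HP : good P, A (exist _ P HP)).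
    assert (Hg : forall P, C P -> good P) by (intros P [HP _]; exact HP).
    assert (Htot : forall P P', C P -> C P' -> extends P P' \/ extends P' P).
    { intros P P' [HP H] [HP' H']. apply (HA _ _ H H'). }
    assert (Hun : forall P, C P -> exists P', C P' /\ below P P').
    { intros P [HP H]. apply NNPP. intros Hnb. apply Hn. exists (exist _ P HP).
      split; [assumption|]. intros [P' HP'] H'. simpl.
      destruct (HA _ _ H H') as [[E|Hb]|Hb]; simpl in *; [| |assumption].
      - left. congruence.
      - exfalso. apply Hnb. exists P'. split; [exists HP'|]; assumption. }
    assert (Hin : exists P, C P).
    { destruct Hne as [[P HP] H]. exists P, HP. exact H. }
    exists (exist _ (union_piece C) (union_good C Hg Htot Hun Hin)).
    intros [P HP] H. right. simpl. apply union_bound; try assumption.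
    exists HP. exact H.
  - exists P. split; [assumption|]. intros Hc.
    destruct (extend_piece P HP Hc) as [P' [HP' [Hb [x [Hx Hnx]]]]].
    destruct (Hmax (exist _ P' HP') (or_intror Hb)) as [E|[H _]]; simpl in *.
    + subst P'. contradiction.
    + apply Hnx, (good_sub P HP), H, Hx.
Qed.
End Construction.

(** * The two models *)

Lemma countable_subset_image {X Y : Type} (A : X -> Prop) (f : X -> Y) :
  countable_subset A -> countable_subset (fun y => exists x, A x /\ y = f x).
Proof.
  intros [g Hg].
  destruct (choice (fun y i => forall x0, A x0 /\ y = f x0 ->
    exists x, A x /\ y = f x /\ g x = i)) as [num Hnum].
  { intros y. destruct (classic (exists x, A x /\ y = f x)) as [[x [H1 H2]]|H].
    - exists (g x). eauto.
    - exists 0. intros x H'. exfalso. eauto. }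
  exists num. intros y y' [x Hx] [x' Hx'] H.
  destruct (Hnum y x Hx) as [z [H1 [-> H2]]], (Hnum y' x' Hx') as [z' [H1' [-> H2']]].
  f_equal. apply Hg; congruence.
Qed.

Lemma countable_subset_preimage {X Y : Type} (B : Y -> Prop) (f : X -> Y) :
  (forall x x', f x = f x' -> x = x') ->
  countable_subset B -> countable_subset (fun x => B (f x)).
Proof. intros Hf [g Hg]. exists (fun x => g (f x)). auto. Qed.

Lemma proj1_sig_inj {X : Type} (D : X -> Prop) (x y : {x | D x}) :
  proj1_sig x = proj1_sig y -> x = y.
Proof.
  destruct x as [x hx], y as [y hy]. simpl. intros ->. f_equal. apply proof_irrelevance.
Qed.

Lemma size_aleph1_uncountable {X : Type} :
  size_aleph1 X -> ~ countable_subset (fun _ : X => True).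
Proof. intros [H _] [f Hf]. apply H. exists f. auto. Qed.

(** An uncountable part of [D] is equinumerous with [X], and so is [D]; the bijection sought is the
    composite of these two. *)
Lemma size_aleph1_subset {X : Type} (D : X -> Prop) :
  size_aleph1 X -> ~ countable_subset D -> size_aleph1 {x | D x}.
Proof.
  intros [_ HX] HD. split.
  - intros [f Hf]. apply HD.
    apply countable_subset_mono with (fun y => exists x : {x | D x}, True /\ y = proj1_sig x).
    + intros x Hx. exists (exist _ x Hx). auto.
    + apply countable_subset_image. exists f. auto.
  - intros A HA. pose (A' := fun y => exists x, A x /\ y = proj1_sig x).
    assert (HA' : ~ countable_subset A').
    { intros Hc. apply HA.
      apply countable_subset_mono with (fun x => A' (proj1_sig x)).
      - intros x Hx. exists x. auto.
      - apply (countable_subset_preimage A' (@proj1_sig X D)); [|assumption].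
        apply proj1_sig_inj. }
    destruct (HX A' HA') as [f [Hf1 Hf2]], (HX D HD) as [g [Hg1 Hg2]].
    destruct (choice (fun x y => g y = x) Hg2) as [g' Hg'].
    pose (inc := fun u : {x | A x} => exist A' (proj1_sig (proj1_sig u))
      (ex_intro _ (proj1_sig u) (conj (proj2_sig u) eq_refl))).
    exists (fun u => g' (f (inc u))). split.
    + intros u v H. apply (f_equal g) in H. rewrite !Hg' in H. apply Hf1 in H.
      apply (f_equal (@proj1_sig X A')) in H. apply proj1_sig_inj, proj1_sig_inj, H.
    + intros y. destruct (Hf2 (g y)) as [[z Hz] Ez].
      pose proof Hz as Hz'. destruct Hz' as [x [Hx Exz]].
      exists (exist _ x Hx). apply Hg1. rewrite Hg', <- Ez. f_equal.
      apply proj1_sig_inj. simpl. auto.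
Qed.

(** The construction is forgotten except for what a comparison needs. The omission clause speaks of
    every copy [a'] of [a], since an isomorphism may move the distinguished tuple anywhere; the set
    [B] replaces a countable elementary submodel by realizing over [a'] all finite types that [K]
    realizes over [a]. *)
Record rich_model {L : Lang} (K : Structure L) (k : nat) (a : nat -> K) (n : nat)
    (q : invariant_type K k a n) (r : formula L * formula L -> Prop)
    (N : Structure L) (aN : nat -> N) : Prop := {
  rich_loc : forall s : nat -> N, locally_realized K (fun phi => sat N s phi);
  rich_tuple : matches K (fun phi => sat N aN phi) k a;
  rich_follows : forall B : N -> Prop, countable_subset B -> exists c : nat -> N,
    forall s u, (forall i, B (s i)) ->
      realized_by K (fun phi => sat N (prepend k aN s) phi) (prepend k a u) ->
      forall phi, holds K k a n q u phi <-> sat N (prepend n c s) phi;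
  rich_omits : forall a' : nat -> N, matches K (fun phi => sat N a' phi) k a ->
    exists B : N -> Prop, countable_subset B /\
      (forall u m, exists s, (forall i, B (s i)) /\
         matches K (fun phi => sat N (prepend k a' s) phi) (k + m) (prepend k a u)) /\
      forall w d, ~ forall j, r j <-> exists chi, proc K k a n q w j chi /\
        exists s, (forall i, B (s i)) /\ sat N (prepend (arity K k n w) d s) chi
}.

Lemma prepend_shift {A : Type} k (a b s : nat -> A) :
  (forall i, i < k -> s i = a i) -> (forall i, s (k + i) = b i) -> s = prepend k a b.
Proof.
  intros H1 H2. extensionality i. unfold prepend. decide_lt; [auto|].
  rewrite <- H2. f_equal. lia.
Qed.

Lemma rich_model_exists {L : Lang} (T : formula L -> Prop) (K : Structure L) (X : Type)
    (k : nat) (a : nat -> K) (n : nat) (q : invariant_type K k a n)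
    (r : formula L * formula L -> Prop) :
  (forall phi, T phi -> sentence phi) ->
  atomic_model T K -> countable_type K -> size_aleph1 X ->
  (forall w (d : list K), ~ forall j, r j <->
    exists chi, proc K k a n q w j chi /\
      exists s : nat -> K, sat K (prepend (arity K k n w) (entry K d) s) chi) ->
  exists (N : Structure L) (aN : nat -> N),
    atomic_model T N /\ size_aleph1 N /\ rich_model K k a n q r N aN.
Proof.
  intros Hsent [HT HK] Hc HX Hr.
  pose proof (size_aleph1_uncountable HX) as Hunc.
  destruct (nat_embeds_in_uncountable _ Hunc) as [f [_ Hf]].
  pose proof Hc as [nu Hnu].
  pose (j := fun m => f (nu m)).
  assert (Hj : forall m m', j m = j m' -> m = m') by (intros; apply Hnu, Hf; assumption).
  destruct (choice (fun x m => (exists m', x = j m') -> x = j m)) as [e He'].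
  { intros x. destruct (classic (exists m', x = j m')) as [[m Hm]|H].
    - eauto.
    - exists (default K). contradiction. }
  assert (He : forall m, e (j m) = m).
  { intros m. symmetry. apply Hj, He'. eauto. }
  pose (aD := fun i => j (a i)).
  pose (P0 := {| pD := fun y => exists m, y = j m;
                 pDelta := fun phi s => sat K (fun i => e (s i)) phi;
                 pE := fun _ => False; pG := fun _ _ => False |}).
  assert (HP0 : good K k a n q X aD r P0).
  { split; simpl; try contradiction.
    - apply diagram_copy; [exact He|intros i; exists (a i); reflexivity|].
      intros phi _. unfold aD. apply sat_agree. intros x _. apply He.
    - left. apply countable_subset_range, Hc. }
  destruct (maximal_piece K HK Hc k a n q X aD Hunc r Hr P0 HP0) as [P [HP HPunc]].
  pose proof (good_diagram _ _ _ _ _ _ _ _ _ HP) as HD.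
  pose proof (dg_base _ _ _ _ _ _ _ HD) as Hbase.
  assert (Hcov : forall x, pD X P x -> pE X P x).
  { destruct (good_covers _ _ _ _ _ _ _ _ _ HP); [contradiction|assumption]. }
  set (D := pD X P) in *. set (Delta := pDelta X P) in *. set (G := pG X P) in *.
  pose (N := diagram_structure K k a X aD D Delta HD).
  assert (Hsat : forall (s : nat -> N) phi, sat N s phi <-> Delta phi (fun i => proj1_sig (s i))).
  { intros s phi. apply diagram_sat. }
  assert (Hval : forall s : nat -> N, into X D (fun i => proj1_sig (s i))).
  { intros s i. apply proj2_sig. }
  pose (lift := fun (s : nat -> X) (Hs : into X D s) => (fun i => exist D (s i) (Hs i)) : nat -> N).
  assert (Hin : forall x, D x -> forall y, G x y -> D y).
  { intros x Hx. apply (good_in _ _ _ _ _ _ _ _ _ HP), Hcov, Hx. }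
  assert (Hchain : forall x y, D x -> D y ->
    (forall z, G x z -> G y z) \/ (forall z, G y z -> G x z)).
  { intros x y Hx Hy. apply (good_chain _ _ _ _ _ _ _ _ _ HP); auto. }
  assert (Hself : forall x, D x -> G x x).
  { intros x Hx. apply (good_self _ _ _ _ _ _ _ _ _ HP), Hcov, Hx. }
  exists N, (lift aD Hbase). split; [|split; [apply size_aleph1_subset; assumption|split]].
  - apply diagram_atomic_model; assumption.
  - intros s m. destruct (dg_locally_realized K k a X aD D Delta HD _ (Hval s) m) as [t Ht].
    exists t. intros phi Hphi. rewrite Hsat. apply Ht, Hphi.
  - intros phi Hphi. rewrite Hsat. apply (dg_tuple _ _ _ _ _ _ _ HD phi Hphi).
  - intros B HB.
    assert (Hx : exists x, D x /\ forall y, B y -> G x (proj1_sig y)).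
    { (* otherwise [D] would be the union of the countable sets [G y], [y] in [B] *)
      apply NNPP. intros Hn. apply HPunc.
      destruct HB as [num Hnum].
      apply countable_subset_mono with
        (fun x => exists i, exists y, B y /\ num y = i /\ G (proj1_sig y) x).
      - intros x Hx. apply NNPP. intros Hx'. apply Hn. exists x. split; [assumption|].
        intros y Hy. destruct (Hchain x (proj1_sig y) Hx (proj2_sig y)) as [h|h].
        + exfalso. apply Hx'. exists (num y), y. auto.
        + apply h, Hself, proj2_sig.
      - apply countable_subset_union; [apply countable_nat|]. intros i.
        destruct (classic (exists y, B y /\ num y = i)) as [[y [Hy Hi]]|Hno].
        + apply countable_subset_mono with (G (proj1_sig y)).
          * intros x [y' [Hy' [Hi' H]]]. replace y with y'; [assumption|].
            apply Hnum; congruence.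
          * apply (good_countable _ _ _ _ _ _ _ _ _ HP), Hcov, proj2_sig.
        + exists (fun _ => 0). intros x x' [y [Hy [Hi _]]]. exfalso. eauto. }
    destruct Hx as [x [Hx HBx]].
    destruct (good_follows _ _ _ _ _ _ _ _ _ HP x (Hcov x Hx)) as [c [Hc1 Hc2]].
    exists (lift c Hc1). intros s u Hs Hu phi. rewrite Hsat, (prepend_comp (@proj1_sig X D)).
    apply Hc2; [intros i; apply HBx, Hs|].
    intros psi. rewrite <- (Hu psi), Hsat, (prepend_comp (@proj1_sig X D)). reflexivity.
  - intros a' Ha'.
    assert (Hx : exists x, D x /\ forall i, i < k -> G x (proj1_sig (a' i))).
    (* Stages form a chain, so finitely many points lie in the largest of their stages. *)
    { clear Ha'. generalize k as m. intros m. induction m as [|m [x [Hx IH]]].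
      - exists (aD 0). split; [apply Hbase|]. intros; lia.
      - pose proof (proj2_sig (a' m)) as Hm. pose proof (Hself _ Hm) as Hs.
        destruct (Hchain x _ Hx Hm) as [h|h]; [exists (proj1_sig (a' m))|exists x];
          (split; [assumption|]); intros i Hi;
          (destruct (Nat.eq_dec i m) as [->|Hne]; [auto|]);
          [apply h, IH; lia|apply IH; lia]. }
    destruct Hx as [x [Hx Hax]].
    pose proof (good_stage _ _ _ _ _ _ _ _ _ HP x (Hcov x Hx)) as HS.
    exists (fun y => G x (proj1_sig y)). split; [|split].
    + apply (countable_subset_preimage (G x) (@proj1_sig X D)); [apply proj1_sig_inj|].
      apply (good_countable _ _ _ _ _ _ _ _ _ HP), Hcov, Hx.
    (* The stage is itself a diagram, so types over [a'] are realized inside it. The entries of [s0]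
       after [a'] are mere fillers. *)
    + intros u m. pose (s0 := prepend k (fun i => proj1_sig (a' i)) aD).
      assert (Hs0 : into X (G x) s0).
      { intros i. apply (prepend_all (G x)); [assumption|].
        apply (dg_base _ _ _ _ _ _ _ HS). }
      destruct (dg_realize K HK k a X aD (G x) Delta HS s0 k (prepend k a u) Hs0)
        with (l := m) as [s [H1 [H2 H3]]].
      * intros phi Hphi. rewrite (sat_agree_below K phi k (prepend k a u) a Hphi).
        2: { intros i Hi. apply prepend_lt, Hi. }
        rewrite <- (Ha' phi Hphi), Hsat.
        apply (dg_agree_iff K k a X aD D Delta HD).
        -- apply into_mono with (G x); [apply Hin, Hx|assumption].
        -- apply Hval.
        -- intros i Hi. apply (prepend_lt k (fun i => proj1_sig (a' i))), Hphi, Hi.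
      * assert (Hs' : into X D (fun i => s (k + i))) by (intros i; apply (Hin x Hx), H1).
        exists (lift _ Hs'). split; [intros i; apply H1|].
        intros phi Hphi. rewrite <- (H3 phi Hphi), Hsat, (prepend_comp (@proj1_sig X D)).
        change (Delta phi (prepend k (fun i => proj1_sig (a' i)) (fun i => s (k + i)))
          <-> Delta phi s).
        rewrite <- (prepend_shift k (fun i => proj1_sig (a' i)) (fun i => s (k + i)) s).
        -- reflexivity.
        -- intros i Hi. rewrite H2 by assumption. unfold s0.
           apply (prepend_lt k (fun i => proj1_sig (a' i))), Hi.
        -- reflexivity.
    + intros w d Hrw.
      apply (good_omits _ _ _ _ _ _ _ _ _ HP x (Hcov x Hx) w (fun i => proj1_sig (d i)) (Hval d)).
      intros i. rewrite Hrw. split.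
      * intros [chi [H1 [s [H2 H3]]]]. exists chi. split; [assumption|].
        exists (fun y => proj1_sig (s y)). split; [exact H2|].
        apply Hsat in H3. rewrite (prepend_comp (@proj1_sig X D)) in H3. exact H3.
      * intros [chi [H1 [s [H2 H3]]]]. exists chi. split; [assumption|].
        assert (Hs : into X D s) by (intros y; apply (Hin x Hx), H2).
        exists (lift s Hs). split; [exact H2|].
        apply Hsat. rewrite (prepend_comp (@proj1_sig X D)). exact H3.
Qed.

(** * Comparing the two models *)

Lemma isomorphism_sat {L : Lang} (M N : Structure L) (f : M -> N) (g : N -> M) :
  (forall y, f (g y) = y) -> (forall x, g (f x) = x) ->
  (forall fs args, f (funs M fs args) = funs N fs (fun j => f (args j))) ->
  (forall r args, rels M r args <-> rels N r (fun j => f (args j))) ->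
  elementary_embedding M N f.
Proof.
  intros Hfg Hgf Hfuns Hrels.
  assert (Heval : forall t s, f (eval M s t) = eval N (fun i => f (s i)) t).
  { induction t as [x|fs args IH]; intros s; simpl; [reflexivity|].
    rewrite Hfuns. f_equal. extensionality j. apply IH. }
  intros phi. induction phi as [t u|r args| |phi IH1 psi IH2|x phi IH]; simpl; intros s.
  - rewrite <- !Heval. split; [congruence|]. intros H. apply (f_equal g) in H.
    rewrite !Hgf in H. exact H.
  - rewrite Hrels. replace (fun j => f (eval M s (args j)))
      with (fun j => eval N (fun i => f (s i)) (args j)); [reflexivity|].
    extensionality j. symmetry. apply Heval.
  - reflexivity.
  - rewrite IH1, IH2. reflexivity.
  - split; intros H m.
    + specialize (H (g m)). apply IH in H. rewrite upd_comp, Hfg in H. exact H.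
    + apply IH. rewrite upd_comp. apply H.
Qed.

Definition real_of {L : Lang} (K : Structure L) k a n (p : invariant_type K k a n)
    (j : formula L * formula L) : Prop :=
  exists u, sat K (prepend k a u) (snd j) /\ holds K k a n p u (fst j).

(** The empty code does not mention [q], so in [N'] it decodes [p] just as well: applied to the
    image of a realization of [p], it yields exactly the real that [N'] omits. *)
Lemma rich_models_not_isomorphic {L : Lang} (K N N' : Structure L)
    (k : nat) (a : nat -> K) (n : nat) (p q : invariant_type K k a n)
    (r : formula L * formula L -> Prop) (aN : nat -> N) (aN' : nat -> N') :
  atomic_set K (fun _ => True) ->
  rich_model K k a n p r N aN ->
  rich_model K k a n q (real_of K k a n p) N' aN' -> ~ isomorphic N N'.
Proof.
  intros HK HN HN' [f [g [Hgf [Hfg [Hfuns Hrels]]]]].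
  pose proof (isomorphism_sat N N' f g Hfg Hgf Hfuns Hrels) as Hf.
  pose (a' := fun i => f (aN i)).
  destruct (rich_omits _ _ _ _ _ _ _ _ HN' a') as [B [HB [Hreal Homit]]].
  { intros phi Hphi. unfold a'. rewrite <- (Hf phi aN).
    apply (rich_tuple _ _ _ _ _ _ _ _ HN phi Hphi). }
  destruct (rich_follows _ _ _ _ _ _ _ _ HN (fun x => B (f x))) as [c Hc].
  { apply countable_subset_preimage; [|assumption]. intros x x' H.
    rewrite <- (Hgf x), <- (Hgf x'), H. reflexivity. }
  pose (c' := fun i => f (c i)).
  assert (Hc' : forall s u, (forall i, B (s i)) ->
    realized_by K (fun phi => sat N' (prepend k a' s) phi) (prepend k a u) ->
    forall phi, holds K k a n p u phi <-> sat N' (prepend n c' s) phi).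
  { intros s u Hs Hu phi.
    assert (E : s = fun i => f (g (s i))) by (extensionality i; symmetry; apply Hfg).
    rewrite E in Hs |- *. unfold c'.
    rewrite <- prepend_comp, <- (Hf phi (prepend n c (fun i => g (s i)))).
    apply Hc; [exact Hs|]. intros psi. rewrite <- (Hu psi), (Hf psi), prepend_comp, <- E.
    reflexivity. }
  assert (Hpull : forall s m t, matches K (fun phi => sat N' (prepend k a' s) phi) (k + m)
      (prepend k a t) -> exists u, (forall i, i < m -> u i = t i) /\
    realized_by K (fun phi => sat N' (prepend k a' s) phi) (prepend k a u)).
  { intros s m t Hm.
    destruct (extend_realization K HK _ _ _ (rich_loc _ _ _ _ _ _ _ _ HN' _) Hm)
      as [h [H1 H2]].
    exists (fun i => h (k + i)). split.
    - intros i Hi. rewrite H2 by lia. apply prepend_ge.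
    - replace (prepend k a (fun i => h (k + i))) with h; [exact H1|].
      apply prepend_shift; [|reflexivity]. intros i Hi. rewrite H2 by lia.
      apply prepend_lt, Hi. }
  apply (Homit nil (prepend n c' a')). intros [phi chi]. simpl arity.
  assert (Hproc : forall theta s, proc K k a n q nil (phi, chi) theta ->
    (sat N' (prepend (n + k) (prepend n c' a') s) theta <->
     sat N' (prepend k a' s) chi /\ sat N' (prepend n c' s) phi)).
  { intros theta s Htheta. simpl in Htheta. rewrite Htheta, prepend_assoc.
    replace (fun i => prepend n c' (prepend k a' s) (n + i)) with (prepend k a' s).
    2: { extensionality i. symmetry. apply prepend_ge. }
    replace (fun i => prepend n c' (prepend k a' s) (if i <? n then i else k + i))
      with (prepend n c' s); [reflexivity|].
    extensionality i. unfold prepend. decide_lt; try lia; try reflexivity. f_equal. lia. }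
  split.
  - intros [u [H1 H2]]. simpl in H1, H2.
    destruct (rename_formula chi (fun i => n + i)) as [chi' [E1 _]].
    destruct (rename_formula phi (fun i => if i <? n then i else k + i)) as [phi' [E2 _]].
    exists (FAnd chi' phi').
    assert (Htheta : proc K k a n q nil (phi, chi) (FAnd chi' phi')).
    { simpl. intros M s. change (sat M s (FAnd chi' phi') <-> sat M (fun i => s (n + i)) chi /\
        sat M (fun i => s (if i <? n then i else k + i)) phi).
      rewrite sat_and, E1, E2. reflexivity. }
    split; [assumption|].
    destruct (formula_fv_below phi) as [b Hb], (formula_fv_below chi) as [b' Hb'].
    (* The witness [u] from [K] is copied into [B] only as far as the free variables of both
       formulas reach. *)
    destruct (Hreal u (b + b')) as [s [Hs Hm]]. exists s. split; [assumption|].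
    apply Hproc; [assumption|]. split.
    + apply Hm; [|assumption]. apply fv_below_mono with b'; [lia|assumption].
    + destruct (Hpull s _ u Hm) as [u' [Hu1 Hu2]].
      apply (Hc' s u' Hs Hu2). revert H2.
      apply holds_agree with (b + b'); [|apply fv_below_mono with b; [lia|assumption]].
      apply Hu1.
  - intros [theta [Htheta [s [Hs Hsat]]]]. apply Hproc in Hsat; [|assumption].
    (* With [m = 0] only the type of the copy of [a] has to agree; the default entries are never
       read. *)
    destruct (Hpull s 0 (fun _ => default K)) as [u [_ Hu]].
    { intros psi Hpsi. rewrite Nat.add_0_r in Hpsi.
      rewrite (sat_agree_below K psi k (prepend k a (fun _ => default K)) a Hpsi)
        by (intros; apply prepend_lt; assumption).
      rewrite (sat_agree_below N' psi k (prepend k a' s) a' Hpsi)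
        by (intros; apply prepend_lt; assumption).
      unfold a'. rewrite <- (Hf psi aN). apply (rich_tuple _ _ _ _ _ _ _ _ HN psi Hpsi). }
    exists u. simpl. split; [apply (Hu chi), Hsat|]. apply (Hc' s u Hs Hu), Hsat.
Qed.

(** * Counting the constrained types *)

Section Counting.
Context {L : Lang} (K : Structure L).
Hypothesis K_atomic : atomic_set K (fun _ => True).
Hypothesis K_countable : countable_type K.
Variables (n : nat) (l : list K).

Let k := length l.
Let a := entry K l.

Definition nonsplitting (p : pretype K) : Prop :=
  in_S_at K n p /\ ~ splits_over K n p (fun x => In x l).

Definition realized (p : pretype K) (b : nat -> K) : Prop :=
  forall phi s, p phi s <-> sat K (prepend n b (fun i => s (n + i))) phi.

Lemma realizes_prepend (N : Structure L) (e : K -> N) c p phi s :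
  realizes K N e n c p ->
  (p phi s <-> sat N (prepend n c (fun i => e (s (n + i)))) phi).
Proof.
  intros Hp. rewrite (Hp phi s). apply sat_agree. intros x _. unfold prepend.
  decide_lt; [reflexivity|]. do 2 f_equal. lia.
Qed.

Lemma same_type_over_list m (u u' : nat -> K) :
  matches K (fun phi => sat K (prepend k a u) phi) (k + m) (prepend k a u') ->
  same_type_over K (fun x => In x l) m u u'.
Proof.
  intros Hm m' theta f Htheta Hf.
  destruct (choice (fun i y => m <= i -> i < m + m' -> y < k /\ a y = f i)) as [pos Hpos].
  { intros i. destruct (classic (m <= i /\ i < m + m')) as [[h1 h2]|h].
    - destruct (In_nth l (f i) (default K) (Hf i h1 h2)) as [y Hy]. exists y. auto.
    - exists 0. tauto. }
  destruct (rename_formula theta (fun i => if i <? m then k + i else pos i))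
    as [theta' [E1 E2]].
  assert (Hfv : fv_below (k + m) theta').
  { intros x Hx. destruct (E2 x Hx) as [y [Hy ->]]. specialize (Htheta y Hy).
    destruct (Nat.ltb_spec y m); [lia|]. destruct (Hpos y); lia. }
  assert (E : forall v, sat K (prepend k a v) theta' <-> sat K (merge m v f) theta).
  { intros v. rewrite E1. apply sat_agree. intros x Hx. specialize (Htheta x Hx).
    unfold merge. destruct (Nat.ltb_spec x m); [apply prepend_ge|].
    destruct (Hpos x) as [h1 h2]; [lia..|]. rewrite prepend_lt; assumption. }
  rewrite <- !E. apply (Hm theta' Hfv).
Qed.

(** Membership in [in_S_at] makes [K] together with one realization an atomic set, which gives local
    realization. Two parameter tuples of the same type over [a] on which [p] disagreed would witness
    splitting over [l]. *)
Lemma invariant_type_of (p : pretype K) : nonsplitting p -> (forall b, ~ realized p b) ->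
  exists q : invariant_type K k a n,
    forall u phi, holds K k a n q u phi <-> p phi (fun i => u (i - n)).
Proof.
  intros [[[N [e [c [He Hp]]]] Hat] Hns] Hnr. specialize (Hat N e c He Hp).
  assert (Hhold : forall u phi,
    sat N (prepend n c (fun i => e (u i))) phi <-> p phi (fun i => u (i - n))).
  { intros u phi. symmetry. apply Hp. }
  assert (Hloc : forall u : nat -> K, locally_realized K
    (fun phi => sat N (prepend n c (fun i => e (u i))) phi)).
  { intros u. apply (locally_realized_in_extension K N e); [assumption|]. intros m.
    apply Hat. intros i _. unfold prepend. decide_lt; eauto. }
  assert (Hinv1 : forall m u u',
    matches K (fun phi => sat K (prepend k a u) phi) (k + m) (prepend k a u') ->
    forall phi, fv_below (n + m) phi ->
      sat N (prepend n c (fun i => e (u i))) phi ->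
      sat N (prepend n c (fun i => e (u' i))) phi).
  { intros m u u' Hm phi Hphi H. apply NNPP. intros H'. apply Hns.
    exists m, u, u', phi. split; [apply same_type_over_list, Hm|].
    split; [assumption|]. split; [apply Hhold, H|].
    apply (Hhold u' (FNot phi)). exact H'. }
  assert (Hinv : forall m u u',
    matches K (fun phi => sat K (prepend k a u) phi) (k + m) (prepend k a u') ->
    forall phi, fv_below (n + m) phi ->
      (sat N (prepend n c (fun i => e (u i))) phi <->
       sat N (prepend n c (fun i => e (u' i))) phi)).
  { intros m u u' Hm phi Hphi. split; apply (Hinv1 m); try assumption.
    intros psi Hpsi. symmetry. apply (Hm psi Hpsi). }
  assert (Hnew : exists i, i < n /\ forall m, c i <> e m).
  { apply NNPP. intros Hn.
    destruct (choice (fun i y => i < n -> c i = e y)) as [b Hb].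
    { intros i. apply NNPP. intros H. apply Hn. exists i. split.
      - apply NNPP. intros Hi. apply H. exists (default K). contradiction.
      - intros m Hm. apply H. eauto. }
    apply (Hnr b). intros phi s. rewrite (realizes_prepend N e c p phi s Hp).
    rewrite (He phi). apply sat_agree. intros x _. unfold prepend. decide_lt; auto. }
  exists {| it_N := N; it_e := e; it_c := c; it_elem := He; it_loc := Hloc;
            it_inv := Hinv; it_new := Hnew |}.
  exact Hhold.
Qed.

(** The first [n] positions of an assignment belong to the type variables and are ignored; truncated
    subtraction overwrites them with [s n]. *)
Lemma pretype_shift (p : pretype K) phi s :
  in_S_at K n p -> (p phi s <-> p phi (fun i => s (n + (i - n)))).
Proof.
  intros [[N [e [c [_ Hp]]]] _]. rewrite !(realizes_prepend N e c p _ _ Hp).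
  replace (fun i => e (s (n + (n + i - n)))) with (fun i => e (s (n + i))); [reflexivity|].
  extensionality i. do 2 f_equal. lia.
Qed.

(** Pairing [phi] with a formula isolating the type of [u] over [a] turns membership of [phi] in the
    type over [u] into one bit of the real: by invariance any witness of that bit is as good as
    [u]. *)
Lemma real_of_determines (q q' : invariant_type K k a n) :
  (forall j, real_of K k a n q j <-> real_of K k a n q' j) ->
  forall u phi, holds K k a n q u phi -> holds K k a n q' u phi.
Proof.
  intros H u phi Hphi. destruct (formula_fv_below phi) as [b Hb].
  destruct (complete_formula K K_atomic (k + b) (prepend k a u)) as [chi [H1 [H2 H3]]].
  destruct (proj1 (H (phi, chi))) as [u' [H4 H5]]; [exists u; auto|].
  apply (holds_inv K k a n q' b u u'); [apply H3, H4| |exact H5].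
  apply fv_below_mono with b; [lia|assumption].
Qed.

(** Being realized by a given tuple, or having a given real, singles out at most one nonsplitting
    type. Countably many such exclusions cannot exhaust a family that has no enumeration. *)
Lemma nonsplitting_avoiding (R : code K * list K -> formula L * formula L -> Prop) :
  ~ (exists g : nat -> pretype K, forall p, nonsplitting p ->
       exists i, forall phi s, g i phi s <-> p phi s) ->
  exists q : invariant_type K k a n, forall i, ~ forall j, real_of K k a n q j <-> R i j.
Proof.
  intros Hno.
  pose (I := (list K + code K * list K)%type).
  assert (HI : countable_type I).
  { apply countable_sum; [apply countable_list, K_countable|].
    apply countable_prod; [apply countable_code|apply countable_list]; exact K_countable. }
  destruct HI as [num Hnum].
  destruct (countable_subset_enum (fun _ : I => True) (inl nil) Logic.I) as [enum [_ Henum]].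
  { exists num. auto. }
  pose (C := fun (z : I) (p : pretype K) => match z with
    | inl b => realized p (entry K b)
    | inr i => exists q : invariant_type K k a n,
        (forall u phi, holds K k a n q u phi <-> p phi (fun i => u (i - n))) /\
        forall j, real_of K k a n q j <-> R i j
    end).
  assert (Huniq : forall z p p', nonsplitting p -> nonsplitting p' -> C z p -> C z p' ->
            forall phi s, p phi s -> p' phi s).
  { intros [b|i] p p' Hp Hp' H H' phi s Hphi; simpl in H, H'.
    - apply H', H, Hphi.
    - destruct H as [q [Hq1 Hq2]], H' as [q' [Hq1' Hq2']].
      apply (pretype_shift p phi s (proj1 Hp)) in Hphi.
      apply (pretype_shift p' phi s (proj1 Hp')).
      apply (Hq1' (fun i => s (n + i))). apply (Hq1 (fun i => s (n + i))) in Hphi.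
      apply real_of_determines with q; [|assumption].
      intros j. rewrite Hq2, Hq2'. reflexivity. }
  destruct (choice (fun i g => forall p, nonsplitting p -> C (enum i) p ->
    forall phi s, g phi s <-> p phi s)) as [g Hg].
  { intros i. destruct (classic (exists p, nonsplitting p /\ C (enum i) p)) as [[p [Hp HC]]|Hn].
    - exists p. intros p' Hp' HC' phi s. split; apply (Huniq (enum i)); assumption.
    - exists (fun _ _ => True). intros p Hp HC. exfalso. eauto. }
  assert (Hex : exists p, nonsplitting p /\ forall z, ~ C z p).
  { apply NNPP. intros Hn. apply Hno. exists g. intros p Hp. apply NNPP. intros Hp'.
    apply Hn. exists p. split; [assumption|]. intros z Hz.
    destruct (Henum z Logic.I) as [i ->]. apply Hp'. exists i. apply Hg; assumption. }
  destruct Hex as [p [Hp HC]].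
  destruct (invariant_type_of p Hp) as [q Hq].
  { intros b Hb. apply (HC (inl (map b (seq 0 n)))). intros phi s. rewrite (Hb phi s).
    apply sat_agree. intros x _. unfold prepend. decide_lt; [|reflexivity].
    symmetry. apply nth_map_seq. assumption. }
  exists q. intros i Hi. apply (HC (inr i)). exists q. auto.
Qed.

Lemma nonsplitting_enumerable (T : formula L -> Prop) :
  (forall phi, T phi -> sentence phi) -> is_model T K -> aleph1_categorical_At T ->
  exists g : nat -> pretype K, forall p, nonsplitting p ->
    exists i, forall phi s, g i phi s <-> p phi s.
Proof.
  intros Hsent HT [[X [_ HX]] Hcat]. apply NNPP. intros Hno.
  assert (Hnext : forall q : invariant_type K k a n, exists q' : invariant_type K k a n,
    exists N aN, atomic_model T N /\ size_aleph1 N /\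
      rich_model K k a n q (real_of K k a n q') N aN).
  { intros q.
    destruct (nonsplitting_avoiding (fun wd j => exists chi, proc K k a n q (fst wd) j chi /\
      exists s : nat -> K,
        sat K (prepend (arity K k n (fst wd)) (entry K (snd wd)) s) chi) Hno) as [q' Hq'].
    exists q'. apply rich_model_exists with X; try assumption.
    - split; assumption.
    - intros w d. apply (Hq' (w, d)). }
  (* The reals to be avoided are irrelevant here; any nonrealized nonsplitting type can start. *)
  destruct (nonsplitting_avoiding (fun _ _ => False) Hno) as [q0 _].
  (* The model [N'] realizes [q0] and omits the real of [q1]; [N] realizes [q1], its own omitted
     real being that of a further type [q2]. *)
  destruct (Hnext q0) as [q1 [N' [aN' [H1 [H2 H3]]]]].
  destruct (Hnext q1) as [q2 [N [aN [H4 [H5 H6]]]]].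
  apply (rich_models_not_isomorphic K N N' k a n q1 q0 _ aN aN' K_atomic H6 H3).
  apply Hcat; assumption.
Qed.

End Counting.

Theorem theorem2p2p1 (L : Lang) (T : formula L -> Prop) :
  countable_language L ->
  complete_theory T ->
  (exists M0 : Structure L, atomic_model T M0 /\ ~ countable_type M0) ->
  aleph1_categorical_At T ->
  forall M : Structure L, atomic_model T M -> countable_type M -> countable_C M.
Proof.
  intros _ [Hsent _] _ Hcat M [HT HM] Hc.
  (* A constrained type is fixed by its number of variables, a list of the finite set over which it
     does not split, and its place in the enumeration for these data. *)
  destruct (choice (fun (nl : nat * list M) (g : nat -> pretype M) =>
    forall p, nonsplitting M (fst nl) (snd nl) p ->
      exists i, forall phi s, g i phi s <-> p phi s)) as [G HG].
  { intros [n l]. apply (nonsplitting_enumerable M HM Hc n l T); assumption. }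
  destruct (countable_prod (countable_prod countable_nat (countable_list Hc)) countable_nat)
    as [num Hnum].
  destruct (countable_subset_enum (fun _ : (nat * list M) * nat => True) (0, nil, 0) I)
    as [enum [_ Henum]].
  { exists num. auto. }
  exists (fun i => (fst (fst (enum i)), G (fst (enum i)) (snd (enum i)))).
  intros n p [Hat [F [[l Hl] Hns]]].
  assert (HF : F = fun x => In x l).
  { extensionality x. apply propositional_extensionality, Hl. }
  subst F. destruct (HG (n, l) p (conj Hat Hns)) as [i Hi].
  destruct (Henum (n, l, i) I) as [z Hz]. exists z. rewrite <- Hz. auto.
Qed.
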